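(* There is a polynomial-time algorithm that, given a temporal graph $(G,\lambda)$ with $G=(V,E)$, decides whether $(G,\lambda)$ admits a temporally transitive orientation of $E$ and, if so, outputs one. In particular, Temporal Transitive Orientation (TTO) is solvable in polynomial time.
   Context: A temporal graph is a pair $(G,\lambda)$ with $G=(V,E)$ a finite simple undirected graph and $\lambda:E\to\mathbb{N}$. A proper orientation $F$ of $E$ contains exactly one of $uv$, $vu$ for every $\{u,v\}\in E$; $(uv,t)$ denotes edge $\{u,v\}$ with label $t$ oriented as $uv$. $F$ is temporally transitive if whenever $(uv,t_1)$ and $(vw,t_2)$ are oriented time-edges with $t_2\ge t_1$, there is an oriented time-edge $(uw,t_3)$ with $t_3\ge t_2$. TTO asks whether a given temporal graph admits a temporally transitive orientation. *)

(* Defs.v *)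
From HB Require Import structures.
From mathcomp Require Import all_boot all_order all_algebra.

Set Implicit Arguments.
Unset Strict Implicit.
Unset Printing Implicit Defensive.

(* [label] is total on vertex sets; its values outside [edges] are never
   consulted, neither below nor by the encoding of instances. *)
Record temporal_graph := TemporalGraph {
  vertex : finType;
  edges : {set {set vertex}};
  edges_card2 : forall e : {set vertex}, e \in edges -> #|e| = 2;
  label : {set vertex} -> nat
}.

Section Orientations.
Variable G : temporal_graph.
Implicit Types (u v w : vertex G) (F : {set vertex G * vertex G}).

Definition adj u v : bool := [set u; v] \in edges G.
Definition time u v : nat := label [set u; v].

Definition proper_orientation F : Prop :=
  (forall u v, (u, v) \in F -> adj u v) /\
  (forall u v, adj u v -> ((u, v) \in F) (+) ((v, u) \in F)).

Definition temporally_transitive F : Prop :=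
  forall u v w, (u, v) \in F -> (v, w) \in F -> time u v <= time v w ->
    (u, w) \in F /\ time v w <= time u w.

Definition tt_orientation F : Prop :=
  proper_orientation F /\ temporally_transitive F.

End Orientations.

(* Model of computation: deterministic structured programs acting on finitely
   many stacks of bits.  This is the textbook multi-stack machine: each unit of
   cost is a constant number of steps of a multi-tape Turing machine (a tape
   being two stacks), and conversely, so polynomial time has its usual
   meaning. *)
Inductive prog : Type :=
| Skip
| Push (k : nat) (b : bool)
| Pop (k : nat)
| Seq (c1 c2 : prog)
| Case (k : nat) (c_empty c_true c_false : prog)
| While (k : nat) (c : prog).

Definition store := nat -> seq bool.

Definition upd (s : store) (k : nat) (x : seq bool) : store :=
  fun j => if j == k then x else s j.

(* [exec c s t s']: started in [s], [c] halts in [s'] at cost [t].  [Case]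
   branches on the top symbol of stack [k]; [While k c] repeats [c] as long as
   stack [k] is nonempty. *)
Inductive exec : prog -> store -> nat -> store -> Prop :=
| exec_Skip s : exec Skip s 1 s
| exec_Push k b s : exec (Push k b) s 1 (upd s k (b :: s k))
| exec_Pop k s : exec (Pop k) s 1 (upd s k (behead (s k)))
| exec_Seq c1 c2 s1 s2 s3 t1 t2 :
    exec c1 s1 t1 s2 -> exec c2 s2 t2 s3 ->
    exec (Seq c1 c2) s1 (t1 + t2) s3
| exec_Case k c_empty c_true c_false s s' t :
    exec (match s k with
          | [::] => c_empty
          | true :: _ => c_true
          | false :: _ => c_false
          end) s t s' ->
    exec (Case k c_empty c_true c_false) s t.+1 s'
| exec_While_stop k c s :
    s k = [::] -> exec (While k c) s 1 s
| exec_While_loop k c s1 s2 s3 t1 t2 :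
    s1 k != [::] -> exec c s1 t1 s2 -> exec (While k c) s2 t2 s3 ->
    exec (While k c) s1 (t1 + t2).+1 s3.

(* The input is on stack 0, first bit on top; so is the output. *)
Definition input_store (x : seq bool) : store :=
  fun k => if k == 0 then x else [::].

Definition halts_within (c : prog) (x : seq bool) (T : nat) (y : seq bool) :
    Prop :=
  exists t s, [/\ exec c (input_store x) t s, t <= T & s 0 = y].

(* A single program, with a polynomial time bound in the length of the encoded
   instance, answers every instance correctly; [correct i y] means that [y] is
   an acceptable output on [i]. *)
Definition polytime_solvable (I : Type) (enc : I -> seq bool)
    (correct : I -> seq bool -> Prop) : Prop :=
  exists (c : prog) (p : {poly nat}), forall i : I,
    exists2 y : seq bool, halts_within c (enc i) p.[size (enc i)]%R y
                        & correct i y.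

Definition polytime_decidable (I : Type) (enc : I -> seq bool)
    (Q : I -> Prop) : Prop :=
  polytime_solvable enc (fun i y => exists2 b : bool, y = [:: b] & b <-> Q i).

(* Binary digits of [t], least significant first, without leading zeros. *)
Definition bits (t : nat) : seq bool :=
  mkseq (fun i => odd (t %/ 2 ^ i)) (up_log 2 t.+1).

(* Self-delimiting: 1 b_0 1 b_1 ... 1 b_k 0. *)
Definition enc_nat (t : nat) : seq bool :=
  flatten [seq [:: true; b] | b <- bits t] ++ [:: false].

(* The number of vertices in unary, ended by 0, then the adjacency matrix in
   row-major order; an entry is 0 for a non-edge and 1 followed by the binary
   label for an edge. *)
Definition enc_entry (G : temporal_graph) (u v : vertex G) : seq bool :=
  if adj u v then true :: enc_nat (time u v) else [:: false].

Definition enc_graph (G : temporal_graph) : seq bool :=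
  nseq #|vertex G| true ++ false ::
    flatten [seq enc_entry u v | u <- enum (vertex G), v <- enum (vertex G)].

(* The characteristic matrix of [F] in row-major order. *)
Definition enc_orientation (G : temporal_graph)
    (F : {set vertex G * vertex G}) : seq bool :=
  [seq (u, v) \in F | u <- enum (vertex G), v <- enum (vertex G)].

Definition TTO (G : temporal_graph) : Prop :=
  exists F : {set vertex G * vertex G}, tt_orientation F.

(* Output 1 followed by a temporally transitive orientation, or 0 if there is
   none. *)
Definition TTO_search (G : temporal_graph) (y : seq bool) : Prop :=
  (exists2 F : {set vertex G * vertex G},
     tt_orientation F & y = true :: enc_orientation F)
  \/ (~ TTO G /\ y = [:: false]).

(* Main.v *)
Require Import Defs.
From Stdlib Require Import FunctionalExtensionality.
From mathcomp Require Import all_boot all_order all_algebra zify.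

Set Implicit Arguments.
Unset Strict Implicit.
Unset Printing Implicit Defensive.

(** Transitivity forbids certain directed paths [a -> v -> b] outright: those
    whose closing edge [ab] is missing or too early, and those on a synchronous
    triangle whose orientation is forced through a fourth vertex ([forbL]).
    Each forbidden path is a pair of mutually contrapositive implications
    between oriented edges, so this part of the problem is a 2-SAT instance; it
    leaves open only cyclically oriented synchronous triangles.

    The key fact is local.  If an orientation closed under the implications has
    a cyclic synchronous triangle with apex [u] over the edge [vw], then every
    oriented edge of it that implies [vw] in one step again spans a cyclic
    synchronous triangle with [u].  Hence an edge of a cyclic triangle is never
    forced by its own reverse, and the edge whose choice brought it into the
    orientation lies on a cyclic triangle with the same apex.  Choosing
    undecided edges from the vertex of smallest index onwards, always outgoing
    from it unless that is self-contradictory, therefore leaves no cyclic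
    triangle: look at the smallest vertex [a] on any of them and at the edge
    entering [a].  So the temporal graph is orientable exactly when the 2-SAT
    instance is satisfiable, and the greedy choice finds an orientation.

    As a program, the greedy choice is a nest of loops over vertices acting on
    bit matrices, and each loop construct costs polynomially many stack
    operations. *)

(** * Forced orientations *)

Section Forcing.
(* Labels shifted so that [T a b = 0] encodes a nonedge. *)
Variables (n : nat) (T : 'I_n -> 'I_n -> nat).
Hypothesis Tsym : forall a b, T a b = T b a.
Implicit Types (a b u v w x y : 'I_n) (e f p : 'I_n * 'I_n).

Definition forbP a v b := (0 < T a v <= T v b) && (T a b < T v b).

(* Here [a -> v] forces [x -> v], then [x -> a], then [b -> a], so [v -> b]
   would close a cycle. *)
Definition forbL a v b x :=
  [&& 0 < T a v, T v b == T a v, T a b == T a v, T a v < T x v,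
      0 < T x a <= T a v & T x b < T a v].

Definition forb a v b := [exists x, forbP a v b || forbL a v b x].

(** The two clauses of a forbidden path [a -> v -> b]: choosing [(a, v)] forces [(b, v)], and
    choosing [(v, b)] forces [(v, a)]. *)
Definition step e f :=
  (f.2 == e.2) && forb e.1 e.2 f.1 || (f.1 == e.1) && forb f.2 e.1 e.2.

Definition flip e := (e.2, e.1).

Lemma flipK : involutive flip. Proof. by case. Qed.

Lemma step_flip e f : step (flip f) (flip e) = step e f.
Proof.
by rewrite /step /flip /= orbC; congr (_ || _); rewrite eq_sym; case: eqP => // ->.
Qed.

Lemma connect_flip e f : connect step (flip f) (flip e) = connect step e f.
Proof.
have imp e' f' : connect step e' f' -> connect step (flip f') (flip e').
  case/connectP=> p; elim: p e' => [|g p IH] e' /= => [_ ->|/andP[eg gp] ef] //.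
  by apply: connect_trans (IH _ gp ef) (connect1 _); rewrite step_flip.
by apply/idP/idP => /imp //; rewrite !flipK.
Qed.

Lemma forb_gt0 a v b : forb a v b -> (0 < T a v) && (0 < T v b).
Proof. by case/existsP=> x /orP[/andP[]|/and5P[]]; lia. Qed.

Lemma step_gt0 e f : step e f -> (0 < T e.1 e.2) /\ (0 < T f.1 f.2).
Proof.
by case/orP=> /andP[/eqP->] /forb_gt0 /andP[h1 h2]; split; rewrite // Tsym.
Qed.

Definition tt_set (F : pred ('I_n * 'I_n)) :=
  [/\ forall a b, F (a, b) -> 0 < T a b,
      forall a b, 0 < T a b -> F (a, b) (+) F (b, a) &
      forall a v b, F (a, v) -> F (v, b) -> T a v <= T v b ->
        F (a, b) /\ T v b <= T a b].

Section Orient.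
Variable F : pred ('I_n * 'I_n).
Hypothesis Fadj : forall a b, F (a, b) -> 0 < T a b.
Hypothesis Ftot : forall a b, 0 < T a b -> F (a, b) || F (b, a).
Hypothesis Fcons : forall a b, F (a, b) -> ~~ F (b, a).

(** No transitive orientation traverses a forbidden path, of either kind. This is the direction that
    turns an unsatisfiable instance into the absence of an orientation. *)
Lemma tt_step_closed :
  (forall a v b, F (a, v) -> F (v, b) -> T a v <= T v b ->
     F (a, b) /\ T v b <= T a b) ->
  forall e f, F e -> step e f -> F f.
Proof.
move=> tt.
have nforb a v b : F (a, v) -> F (v, b) -> ~ forb a v b.
  move=> av vb /existsP[x /orP[/andP[h1 h2]|]].
    by have [|_] := tt _ _ _ av vb; lia.
  case/and5P=> t0 /eqP tvb /eqP tab txv /andP[txa txb].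
  have [|ab _] := tt _ _ _ av vb; first by lia.
  have ? := Tsym x v; have ? := Tsym x a; have ? := Tsym x b.
  have ? := Tsym a v; have ? := Tsym a b; have ? := Tsym v b.
  have xv : F (x, v).
    have /orP[//|vx] : F (x, v) || F (v, x) by apply: Ftot; lia.
    by have [|_] := tt _ _ _ av vx; lia.
  have xa : F (x, a).
    have /orP[//|ax] : F (x, a) || F (a, x) by apply: Ftot; lia.
    by have [|_] := tt _ _ _ ax xv; lia.
  by have [|_] := tt _ _ _ xa ab; lia.
case=> [e1 e2] [f1 f2] Fe /[dup] /step_gt0 /= [_ t0] /orP[] /andP[/= /eqP ? h]; subst.
  by have /orP[//|ve] := Ftot t0; case: (nforb _ _ _ Fe ve).
by have /orP[//|ve] := Ftot t0; case: (nforb _ _ _ ve Fe).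
Qed.

Hypothesis Fclosed : forall e f, F e -> step e f -> F f.

Lemma Fforb a v b : F (a, v) -> F (v, b) -> ~ forb a v b.
Proof.
move=> av vb fb; have := @Fclosed _ (b, v) av.
by rewrite /step /= eqxx fb => /(_ isT) /Fcons; rewrite vb.
Qed.

Lemma FforbP a v b : F (a, v) -> F (v, b) -> T a v <= T v b -> T v b <= T a b.
Proof.
move=> av vb h; rewrite leqNgt; apply/negP => h2; apply: (Fforb av vb).
by apply/existsP; exists a; rewrite /forbP (Fadj av) h h2.
Qed.

Lemma FforbL a v b x : F (a, v) -> F (v, b) -> T v b = T a v ->
  T a b = T a v -> T a v < T x v -> 0 < T x a -> T x a <= T a v ->
  T x b < T a v -> False.
Proof.
move=> av vb h1 h2 h3 h4 h5 h6; apply: (Fforb av vb).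
by apply/existsP; exists x; rewrite /forbL (Fadj av) h1 h2 h3 h4 h5 h6 !eqxx orbT.
Qed.

Definition cyc u v w :=
  [/\ [/\ F (u, v), F (v, w) & F (w, u)], T u v = T v w & T w u = T v w].

Lemma cyc_rot u v w : cyc u v w -> cyc v w u.
Proof. by case=> [[? ? ?] t1 t2]; split; rewrite ?t1 ?t2. Qed.

Ltac orient a b :=
  let h := fresh "F" a b in let h' := fresh "F" b a in
  have /orP[h|h'] : F (a, b) || F (b, a) by [apply: Ftot; lia].
Ltac noP h h' := by move: (FforbP h h'); lia.

(** Here [yw] and [vw] share their head. Nearly every wrong orientation or time completes a [forbP]
    path. What survives is an edge later than the triangle, joining [u] to [y] under [forbP] and to
    [x] under [forbL]; that is exactly a [forbL] configuration, so no third kind of forbidden path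
    is called for. *)
Lemma entry_head u v w y :
  cyc u v w -> F (y, w) -> forb y w v -> cyc u y w.
Proof.
case=> [[uv vw wu] tu tw] yw /existsP[x fb].
move: (Fadj vw) => t0.
have ? := Tsym u v; have ? := Tsym v w; have ? := Tsym w u.
have ? := Tsym y w; have ? := Tsym y v; have ? := Tsym y u.
have ? := Tsym x u; have ? := Tsym x v; have ? := Tsym x w; have ? := Tsym x y.
have yu : T w u <= T y u.
  by apply: (FforbP yw wu); case/orP: fb => [/andP[]|/and5P[]]; lia.
case/orP: fb => [/andP[h1 h2]|/and5P[h1 /eqP h2 /eqP h3 h4 /andP[h5 h6]]].
  have [tyu|tyu] : T y u = T w u \/ T w u < T y u by lia.
    orient y u; first by noP Fyu uv.
    have [h3|h3] : T y w = T w u \/ T y w < T w u by lia.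
      by split; [|lia..].
    by noP wu Fuy.
  by case: (@FforbL w u v y wu uv); lia.
orient x w; last by noP yw Fwx.
orient x y; last by noP Fyx Fxw.
orient v y; last by noP Fxy Fyv.
have [tyu|tyu] : T y u = T w u \/ T w u < T y u by lia.
  orient u y; first by split; [|lia..].
  have [h7|[h7|h7]] : T x u = T v w \/ T v w < T x u \/ T x u < T v w by lia.
  - by orient x u; [noP Fxu uv | noP Fux Fxw].
  - by case: (@FforbL y u v x Fyu uv); lia.
  - by noP Fxy Fyu.
by orient y u; [noP Fvy Fyu | noP wu Fuy].
Qed.

(** Not the mirror image of [entry_head]: the condition on times is not invariant under reversing
    all edges, and here the case [forbP] is settled by [forbP] alone. *)
Lemma entry_tail u v w y :
  cyc u v w -> F (v, y) -> forb w v y -> cyc u v y.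
Proof.
case=> [[uv vw wu] tu tw] vy /existsP[x fb].
move: (Fadj vw) => t0.
have ? := Tsym u v; have ? := Tsym v w; have ? := Tsym w u.
have ? := Tsym y w; have ? := Tsym y v; have ? := Tsym y u.
have ? := Tsym x u; have ? := Tsym x v; have ? := Tsym x w; have ? := Tsym x y.
have yu : T v y <= T u y.
  by apply: (FforbP uv vy); case/orP: fb => [/andP[]|/and5P[]]; lia.
case/orP: fb => [/andP[h1 h2]|/and5P[h1 /eqP h2 /eqP h3 h4 /andP[h5 h6]]].
  orient y u; last by noP wu Fuy.
  have [h3|h3] : T y u = T u v \/ T u v < T y u by lia.
    by split; [|lia..].
  by noP vy Fyu.
have [tyu|tyu] : T y u = T w u \/ T w u < T y u by lia.
  orient y u; first by split; [|lia..].
  have [h7|[h7|h7]] : T x u = T v w \/ T v w < T x u \/ T x u < T v w by lia.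
  - orient x v; last by noP uv Fvx.
    by orient x u; [noP Fxu Fuy | noP Fux Fxv].
  - by case: (@FforbL w u y x wu Fuy); lia.
  - orient x w; first by noP Fxw wu.
    by orient x v; [noP Fwx Fxv | noP uv Fvx].
by orient y u; [noP vy Fyu | noP wu Fuy].
Qed.

Lemma entry_step u e f : step e f -> F e -> cyc u f.1 f.2 -> cyc u e.1 e.2.
Proof.
case: e f => [e1 e2] [f1 f2] /orP[] /andP[/= /eqP-> fb] Fe c.
  exact: entry_head c Fe fb.
exact: entry_tail c Fe fb.
Qed.

Lemma forward_connect e f : F e -> connect step e f -> F f.
Proof.
move=> Fe /connectP[p]; elim: p e Fe => [|g p IH] e Fe /= => [_ ->|/andP[eg]] //.
by apply: IH; apply: Fclosed eg.
Qed.

Lemma entry_connect u e f :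
  connect step e f -> F e -> cyc u f.1 f.2 -> cyc u e.1 e.2.
Proof.
case/connectP=> p; elim: p e => [|g p IH] e /= => [_ ->|/andP[eg gp] ef] // Fe c.
by apply: (entry_step eg Fe); apply: IH => //; apply: Fclosed eg.
Qed.

(** Walk along the implications from [flip p] to [p], keeping the reverse of the current edge [e] on
    a cyclic triangle with apex [u]. If the next edge [f] is oriented as written, it spans such a
    triangle by [entry_connect], and the two triangles orient the edge between [u] and the common
    end of [e] and [f] oppositely. Otherwise [flip f] inherits the triangle through the
    contrapositive implication. *)
Lemma cyc_not_forced u p : cyc u p.1 p.2 -> ~~ connect step (flip p) p.
Proof.
move=> cp.
have key e : connect step e p -> cyc u e.2 e.1 -> False.
  case/connectP=> q; elim: q e => [|f q IH] e /= => [_ pe|/andP[ef fq] pf] ce.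
    by case: ce cp => [[_ h _] _ _] [[_ + _] _ _]; 
    rewrite pe -surjective_pairing => /[dup]; case: (e) h => a b /Fcons /negPf /= ->.
  have fp : connect step f p by apply/connectP; exists q.
  have [_ t0] := step_gt0 ef.
  case/orP: (Ftot t0) => Ff.
    have [[h1 _ h2] _ _] : cyc u f.1 f.2.
      by apply: entry_connect fp _ cp; case: (f) Ff.
    case: ce => [[h3 _ h4] _ _].
    by case/orP: ef => /andP[/eqP E _]; move: h1 h2; rewrite E => h1 h2;
       [move: (Fcons h2); rewrite h3|move: (Fcons h4); rewrite h1].
  apply: (IH f fq pf); apply: (@entry_step u (flip f) (flip e)); rewrite ?step_flip //.
by apply/negP => h; apply: (key (flip p) h).
Qed.

(* [e] is the pair whose choice put [p] in [F]. *)
Hypothesis Fsource : forall p, F p -> exists e,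
  [/\ F e, connect step e p &
      connect step (flip e) e || (e.1 <= p.1) && (e.1 <= p.2)].

(** Strong induction on the index of [u]. The source of the edge [wu] lies on a cyclic triangle with
    apex [v], so it is not forced by its own reverse and its tail has index at most that of [u]. A
    tail equal to [u] contradicts [u -> v]; a smaller one falls under the induction hypothesis. *)
Lemma source_acyclic u v w : ~ cyc u v w.
Proof.
elim/ltn_ind: {u}(nat_of_ord u) {-2}u (erefl (nat_of_ord u)) v w => k IH a ka v w c.
have [[av _ wa] _ _] := c.
have [e [Fe ep]] := Fsource wa.
have c' : cyc v e.1 e.2.
  by apply: (entry_connect ep Fe); apply: cyc_rot c.
case/orP=> [ee|/andP[_ ea]].
  by move: (cyc_not_forced c'); rewrite ee.
have [/val_inj ea'|lt] : val e.1 = val a \/ e.1 < k by rewrite /=; move: ea ka => /=; lia.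
  by case: c' => [[+ _ _] _ _]; rewrite ea' => /Fcons; rewrite av.
exact: (IH _ lt e.1 erefl _ _ (cyc_rot c')).
Qed.

Lemma source_tt : tt_set F.
Proof.
split=> // [a b t0|a v b av vb h].
  by case/orP: (Ftot t0) => h; rewrite h (negPf (Fcons h)).
have h2 := FforbP av vb h; split=> //.
have ? := Tsym a v; have ? := Tsym a b; have ? := Tsym v b; have t0 := Fadj av.
orient a b => //.
(* With [b -> a], a strict inequality makes [v -> b -> a] forbidden, and equality makes the triangle
   synchronous and cyclic. *)
have [h3|h3] : T a v < T a b \/ T a v = T a b by lia.
  by noP vb Fba.
by case: (@source_acyclic a v b); split; [|lia..].
Qed.

End Orient.
End Forcing.

(** * The greedy orientation *)

Section Greedy.
Variables (n : nat) (T : 'I_n -> 'I_n -> nat).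
Hypothesis Tsym : forall a b, T a b = T b a.
Implicit Types (e f p : 'I_n * 'I_n) (A : pred ('I_n * 'I_n)).
Local Notation step := (step T).

Definition conflict A := [exists p, A p && A (flip p)].

Definition adjoin A e : pred ('I_n * 'I_n) := fun p => A p || connect step e p.

(** The reverse is adjoined without a second test. If it conflicts too, the instance is
    unsatisfiable, and since the set only grows the conflict is still visible at the end. *)
Definition choose_at A e :=
  if [&& 0 < T e.1 e.2, ~~ A e & ~~ A (flip e)] then
    if conflict (adjoin A e) then adjoin A (flip e) else adjoin A e
  else A.

(** The classical 2-SAT criterion: a variable and its negation imply each other. *)
Definition unsat :=
  exists e, [/\ 0 < T e.1 e.2, connect step e (flip e) & connect step (flip e) e].

Definition sourced A := forall p, A p -> exists e,
  [/\ A e, connect step e p &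
      connect step (flip e) e || (e.1 <= p.1) && (e.1 <= p.2)].

(** The state before the pair [(i, j)] in lexicographic order. The loop keeps running on an
    unsatisfiable instance, hence the alternative to consistency in the last clause. *)
Definition greedy_inv i j A := [/\ forall e f, A e -> step e f -> A f,
  forall e, A e -> 0 < T e.1 e.2,
  forall e, 0 < T e.1 e.2 -> e.1 < i \/ nat_of_ord e.1 = i /\ e.2 < j ->
    A e || A (flip e) &
  unsat \/ (forall e, A e -> ~~ A (flip e)) /\ sourced A].

Lemma greedy_inv0 : greedy_inv 0 0 (fun=> false).
Proof. by split=> //; [move=> e _ []//; case | right; split]. Qed.

Lemma greedy_inv_row i A : greedy_inv i n A -> greedy_inv i.+1 0 A.
Proof.
case=> h1 h2 h3 h4; split=> // e t0; case=> [|[]//]; rewrite ltnS leq_eqVlt.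
by case/orP=> [/eqP ei|ei]; apply: h3 => //; [right|left].
Qed.

Lemma connect_gt0 e p : connect step e p -> 0 < T e.1 e.2 -> 0 < T p.1 p.2.
Proof.
case/connectP=> q; elim: q e => [|f q IH] e /= => [_ -> //|/andP[ef fq] pf _].
by apply: IH fq pf _; case: (step_gt0 Tsym ef).
Qed.

(** The two alternatives for [e] are the edge leaving [a], adjoined when harmless, and its reverse,
    adjoined when the former conflicts. In the second case [flip e] implies [e], as [sourced]
    allows. In the first, every newly decided edge has both ends of index at least [i], because all
    edges at smaller vertices were decided before. *)
Lemma greedy_inv_adjoin i j A (a b : 'I_n) e : greedy_inv i j A -> a = i :> nat -> b = j :> nat ->
  (e = (a, b) /\ ~~ conflict (adjoin A e) \/
   e = (b, a) /\ conflict (adjoin A (flip e))) ->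
  0 < T a b -> ~~ A (a, b) -> ~~ A (b, a) -> greedy_inv i j.+1 (adjoin A e).
Proof.
case=> Acl Aadj Adone Aalt ai bj ch t0 nab nba.
have tba : 0 < T b a by rewrite Tsym.
have te : 0 < T e.1 e.2 by case: ch => -[-> _].
have ne : ~~ A e /\ ~~ A (flip e) by case: ch => -[-> _].
have Acon f g : A f -> connect step f g -> A g.
  by move=> Af fg; apply: (forward_connect Acl Af fg).
split.
- move=> f g /orP[Af|ef] fg; apply/orP; first by left; apply: Acl fg.
  by right; apply: connect_trans ef (connect1 fg).
- by move=> f /orP[/Aadj //|ef]; apply: connect_gt0 ef te.
- move=> f tf [fi|[fi fj]]; rewrite /adjoin.
    by case/orP: (Adone f tf (or_introl fi)) => ->; rewrite ?orbT.
  move: fj; rewrite ltnS leq_eqVlt => /orP[/eqP fj|fj]; last first.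
    by case/orP: (Adone f tf (or_intror (conj fi fj))) => ->; rewrite ?orbT.
  have -> : f = (a, b).
    by case: (f) fi fj => x y /= ? ?; congr (_, _); apply: val_inj; rewrite /= ?ai ?bj.
  by case: ch => -[-> _]; rewrite connect0 ?orbT.
case: Aalt => [un|[Acons Asrc]]; [by left|].
(* A conflict created by [adjoin A f] comes from [f] alone. *)
have confl f : ~~ A f -> ~~ A (flip f) -> conflict (adjoin A f) -> connect step f (flip f).
  move=> nf nrf /existsP[p /andP[/orP[Ap|fp] /orP[Arp|frp]]].
  - by move: (Acons p Ap); rewrite Arp.
  - by move: (Acon _ (flip f) Ap); rewrite -connect_flip flipK frp => /(_ isT); rewrite (negPf nrf).
  - move: (Acon _ (flip f) Arp); rewrite connect_flip fp => /(_ isT).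
    by rewrite (negPf nrf).
  - by apply: connect_trans fp _; rewrite -[p]flipK connect_flip.
have [cf|ncf] := boolP (conflict (adjoin A e)).
  (* Both directions conflict, so each implies the other and the instance is unsatisfiable. *)
  have ee := confl e ne.1 ne.2 cf.
  case: ch => [[_]|[_ cr]]; first by rewrite cf.
  left; exists e; split=> //; rewrite -{2}[e]flipK; apply: confl; rewrite ?flipK //; first by case: ne.
  by case: ne.
right; split.
  move=> f Bf; apply/negP => Brf; move/negP: ncf; apply; apply/existsP; exists f.
  by rewrite Bf Brf.
move=> p; case: (boolP (A p)) => [Ap _|nAp Bp].
  by have [f [Af fp h]] := Asrc p Ap; exists f; split; rewrite // /adjoin Af.
have ep : connect step e p by move: Bp; rewrite /adjoin (negPf nAp).
exists e; split; rewrite /adjoin ?connect0 ?orbT //.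
case: ch => [[ea _]|[eb cr]]; last first.
  by rewrite -{2}[e]flipK confl ?flipK //; case: ne.
have nArp : ~~ A (flip p).
  apply/negP => Arp; case: ne => _ /negP; apply; apply: Acon Arp _.
  by rewrite connect_flip.
have tp := connect_gt0 ep te.
have h1 : i <= p.1.
  rewrite leqNgt; apply/negP => pi.
  by move: (Adone p tp (or_introl pi)); rewrite (negPf nAp) (negPf nArp).
have h2 : i <= p.2.
  rewrite leqNgt; apply/negP => pi.
  have trp : 0 < T (flip p).1 (flip p).2 by rewrite /= Tsym.
  by move: (Adone (flip p) trp (or_introl pi)); rewrite flipK (negPf nAp) (negPf nArp).
by rewrite ea /= ai h1 h2 orbT.
Qed.

Lemma greedy_inv_choose (i j : 'I_n) A : greedy_inv i j A -> greedy_inv i j.+1 (choose_at A (i, j)).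
Proof.
move=> invA; rewrite /choose_at /=; case: ifP => [/and3P[t0 nij nji]|ass].
  case: ifP => cf; apply: (greedy_inv_adjoin invA erefl erefl) => //.
    by right; rewrite flipK.
  by left; rewrite cf.
case: invA => h1 h2 h3 h4; split=> // e t0 [ei|[ei]]; first by apply: h3 => //; left.
rewrite ltnS leq_eqVlt => /orP[/eqP ej|ej]; last by apply: h3 => //; right.
have ee : e = (i, j).
  by case: (e) ei ej => x y /= /val_inj -> /val_inj ->.
by subst e; move: ass; rewrite t0 /=; case: (A (i, j)) => //= /negbFE.
Qed.

(** If an edge and its reverse imply each other, a closed set contains both or neither. This
    excludes every transitive orientation, and it also excludes [unsat] for a total set without
    conflict, which is therefore sourced. *)
Lemma greedy_inv_end A : greedy_inv n 0 A ->
  (conflict A -> forall F, ~ tt_set T F) /\ (~~ conflict A -> tt_set T A).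
Proof.
case=> Acl Aadj Adone Aalt.
have Atot a b : 0 < T a b -> A (a, b) || A (b, a).
  by move=> t0; apply: (Adone (a, b) t0); left.
split=> [/existsP[p /andP[Ap Arp]] F [Fadj Fx Ftt]|ncf].
  case: Aalt => [[e [te e1 e2]]|[Acons _]]; last by move: (Acons p Ap); rewrite Arp.
  have Ftot a b : 0 < T a b -> F (a, b) || F (b, a).
    by move=> /Fx; case: (F _).
  have Fcl := tt_step_closed Tsym Ftot Ftt.
  have FX : F e = F (flip e).
    by apply/idP/idP => h; apply: (forward_connect Fcl h).
  by move: (Fx _ _ te); rewrite -surjective_pairing FX addbb.
have Acons e : A e -> ~~ A (flip e).
  move=> Ae; apply: contra ncf => Are; apply/existsP; exists e; by rewrite Ae Are.
case: Aalt => [[e [te e1 e2]]|[_ Asrc]].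
  have /orP[Ae|Ae] : A e || A (flip e) by rewrite {1}[e]surjective_pairing Atot.
    by move: (Acons e Ae); rewrite (forward_connect Acl Ae e1).
  by move: (Acons _ Ae); rewrite flipK (forward_connect Acl Ae e2).
apply: (source_tt Tsym) => //; first by move=> a b; apply: Aadj.
by move=> a b; apply: Acons.
Qed.

End Greedy.

(** * Stack programs *)

Ltac store_eq :=
  apply: functional_extensionality => ?; rewrite /upd;
  repeat match goal with |- context [?a == ?b] => case: (a =P b) => ? end;
  subst; try congruence; try lia.

Definition runs c s T s' := exists2 t, exec c s t s' & t <= T.

Lemma runs_le c s T T' s' : runs c s T s' -> T <= T' -> runs c s T' s'.
Proof. by case=> t h tT TT'; exists t => //; apply: leq_trans TT'. Qed.

Lemma runs_eq c s T s1 s2 : runs c s T s1 -> s1 = s2 -> runs c s T s2.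
Proof. by move=> h <-. Qed.

Lemma runs_seq c1 c2 s1 s2 s3 T1 T2 :
  runs c1 s1 T1 s2 -> runs c2 s2 T2 s3 -> runs (Seq c1 c2) s1 (T1 + T2) s3.
Proof.
by case=> t1 h1 l1 [t2 h2 l2]; exists (t1 + t2); [apply: exec_Seq h1 h2|lia].
Qed.

Lemma runs_case k c0 c1 c2 s T s' :
  runs (match s k with [::] => c0 | true :: _ => c1 | false :: _ => c2 end) s T s' ->
  runs (Case k c0 c1 c2) s T.+1 s'.
Proof. by case=> t h l; exists t.+1; [constructor|]. Qed.

(** Symbolic evaluation of straight-line code. The value at [While] is a placeholder; [runs_ev]
    applies to [loopfree] programs. *)
Fixpoint ev c s : store :=
  match c with
  | Skip | While _ _ => s
  | Push k b => upd s k (b :: s k)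
  | Pop k => upd s k (behead (s k))
  | Seq c1 c2 => ev c2 (ev c1 s)
  | Case k c0 c1 c2 =>
    match s k with
    | [::] => ev c0 s | true :: _ => ev c1 s | false :: _ => ev c2 s
    end
  end.

Fixpoint loopfree c :=
  match c with
  | While _ _ => false
  | Seq c1 c2 => loopfree c1 && loopfree c2
  | Case _ c0 c1 c2 => [&& loopfree c0, loopfree c1 & loopfree c2]
  | _ => true
  end.

(** Summing over the branches bounds each of them, so that the cost depends on the program and not
    on the store. *)
Fixpoint ev_cost c :=
  match c with
  | Seq c1 c2 => ev_cost c1 + ev_cost c2
  | Case _ c0 c1 c2 => (ev_cost c0 + ev_cost c1 + ev_cost c2).+1
  | _ => 1
  end.

Lemma runs_ev c s s' : loopfree c -> ev c s = s' -> runs c s (ev_cost c) s'.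
Proof.
move=> + <-; elim: c s => [|k b|k|c1 IH1 c2 IH2|k c0 IH0 c1 IH1 c2 IH2|//] s /=.
- by exists 1 => //; constructor.
- by exists 1 => //; constructor.
- by exists 1 => //; constructor.
- by case/andP=> h1 h2; apply: runs_seq (IH1 s h1) (IH2 _ h2).
case/and3P=> /(IH0 s) [t0 h0 l0] /(IH1 s) [t1 h1 l1] /(IH2 s) [t2 h2 l2].
have: exists2 t, exec (match s k with [::] => c0 | true :: _ => c1 | false :: _ => c2 end)
   s t (ev (Case k c0 c1 c2) s) & t <= ev_cost c0 + ev_cost c1 + ev_cost c2.
  by rewrite /=; case: (s k) => [|[] _]; [exists t0|exists t1|exists t2] => //; lia.
by case=> t h l; exists t.+1 => //; constructor.
Qed.

Lemma runs_while_stop k c s : s k = [::] -> runs (While k c) s 1 s.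
Proof. by exists 1 => //; constructor. Qed.

Lemma runs_while_loop k c s1 s2 s3 T1 T2 :
  s1 k != [::] -> runs c s1 T1 s2 -> runs (While k c) s2 T2 s3 ->
  runs (While k c) s1 (T1 + T2).+1 s3.
Proof.
move=> h0 [t1 h1 l1] [t2 h2 l2]; exists (t1 + t2).+1; last by lia.
exact: exec_While_loop h1 h2.
Qed.

Lemma runs_while k c T m (S : nat -> store) :
  (forall i, i < m -> S i k != [::] /\ runs c (S i) T (S i.+1)) ->
  S m k = [::] -> runs (While k c) (S 0) (m * T.+1 + 1) (S m).
Proof.
elim: m S => [|m IH] S h hm; first exact: runs_while_stop.
have [ne r0] := h 0 isT.
have r : runs (While k c) (S 1) (m * T.+1 + 1) (S m.+1).
  by apply: (IH (fun i => S i.+1)) => // i im; apply: h.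
by apply: runs_le (runs_while_loop ne r0 r) _; lia.
Qed.

Definition clear k := While k (Pop k).

Lemma runs_clear k s s' :
  upd s k [::] = s' -> runs (clear k) s (2 * size (s k) + 1) s'.
Proof.
move=> <-; move: {-1}(s k) (erefl (s k)) => x; elim: x s => [|b x IH] s sk.
  have -> : upd s k [::] = s by store_eq.
  exact: runs_while_stop.
have r : runs (Pop k) s 1 (upd s k x) by apply: runs_ev; rewrite //= sk.
have := IH (upd s k x); rewrite {1}/upd eqxx => /(_ erefl) r2.
have -> : upd s k [::] = upd (upd s k x) k [::] by store_eq.
by apply: runs_le (runs_while_loop _ r r2) _; rewrite ?sk //=; lia.
Qed.

Definition move1 k l :=
  Case k Skip (Seq (Pop k) (Push l true)) (Seq (Pop k) (Push l false)).

Lemma runs_move1 k l b x s s' : k != l -> s k = b :: x ->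
  upd (upd s k x) l (b :: s l) = s' -> runs (move1 k l) s 6 s'.
Proof.
move=> /eqP kl sk <-; apply: (@runs_ev (move1 k l)) => //=; rewrite sk.
by case: b sk => sk /=; store_eq.
Qed.

Definition move k l := While k (move1 k l).

Lemma runs_move k l s s' : k != l ->
  upd (upd s k [::]) l (catrev (s k) (s l)) = s' ->
  runs (move k l) s (7 * size (s k) + 1) s'.
Proof.
move=> kl <-; move: {-1}(s k) (erefl (s k)) => x; elim: x s => [|b x IH] s sk.
  have -> : upd (upd s k [::]) l (catrev [::] (s l)) = s by store_eq.
  exact: runs_while_stop.
have r := runs_move1 kl sk erefl; set s1 := upd _ l _ in r.
have s1k : s1 k = x by rewrite /s1 /upd (negPf kl) eqxx.
have -> : upd (upd s k [::]) l (catrev (b :: x) (s l))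
  = upd (upd s1 k [::]) l (catrev x (s1 l)).
  apply: functional_extensionality => j; rewrite /s1 /upd eqxx.
  by do 2!case: (j =P _) => // _.
by apply: runs_le (runs_while_loop _ r (IH _ s1k)) _; rewrite ?sk //=; lia.
Qed.

(** A bounded loop driven by the unary counter on [k]; the units consumed wait on [z], from where
    the counter is rebuilt. *)
Definition rep k z c := Seq (While k (Seq (Seq (Pop k) (Push z true)) c)) (move z k).

(** [g i] is the store after [i] iterations with the counter stacks as at the start. The body is
    required to run under any contents [a], [b] of these two stacks, since they change from one
    iteration to the next. *)
Lemma runs_rep k z c m T s s' (g : nat -> store) : k != z ->
  s k = nseq m true -> s z = [::] -> g 0 = s -> g m = s' ->
  (forall i, g i k = s k) -> (forall i, g i z = s z) ->
  (forall i a b, i < m -> runs c (upd (upd (g i) k a) z b) T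
                                 (upd (upd (g i.+1) k a) z b)) ->
  runs (rep k z c) s (m * (T + 10) + 2) s'.
Proof.
move=> kz sk sz g0 <- gk gz h.
pose S i := upd (upd (g i) k (nseq (m - i) true)) z (nseq i true).
have kz' : z == k = false by rewrite eq_sym; apply/negbTE.
have r : runs (While k (Seq (Seq (Pop k) (Push z true)) c)) (S 0)
   (m * (2 + T).+1 + 1) (S m).
  apply: runs_while => [i im|]; last by rewrite /S /upd (negPf kz) eqxx subnn.
  split; first by rewrite /S /upd (negPf kz) eqxx -size_eq0 size_nseq; lia.
  apply: runs_seq (h i _ _ im); apply: (@runs_ev (Seq _ _)) => //=.
  rewrite /S; have -> : m - i = (m - i.+1).+1 by lia.
  by apply: functional_extensionality => j; rewrite /upd /= !eqxx ?kz' ?(negPf kz) /=;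
    case: (j =P z) => // ?; case: (j =P k).
have -> : s = S 0.
  apply: functional_extensionality => j; rewrite /S /upd subn0.
  case: (j =P z) => [->|_]; first by rewrite sz.
  by case: (j =P k) => [->|_]; rewrite ?sk ?g0.
have r2 : runs (move z k) (S m) (7 * m + 1) (g m).
  have Smz : S m z = nseq m true by rewrite /S /upd eqxx.
  have := @runs_move z k (S m) (g m); rewrite Smz size_nseq; apply.
    by rewrite kz'.
  apply: functional_extensionality => j; rewrite /S /upd !eqxx ?kz' ?(negPf kz) subnn.
  case: (j =P k) => [->|_]; first by rewrite gk sk catrevE cats0 rev_nseq.
  by case: (j =P z) => [->|//]; rewrite gz sz.
by apply: runs_le (runs_seq r r2) _; lia.
Qed.

(* [rE]: input entries; [rN]: number of vertices in unary; [rV]: values of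
   boolean expressions; [rT]: items already passed while seeking; [rZ], [rY]:
   consumed part of a unary counter; [rR], [rX], [rW]: labels being read or
   compared; [rF]: loop flag; [rM m]: matrix [m]; [rI d], [rC d]: index and
   remaining count of the loop at depth [d]. *)
Notation rE := 0 (only parsing).
Notation rN := 1 (only parsing).
Notation rV := 2 (only parsing).
Notation rT := 3 (only parsing).
Notation rZ := 4 (only parsing).
Notation rY := 5 (only parsing).
Notation rR := 6 (only parsing).
Notation rX := 7 (only parsing).
Notation rW := 8 (only parsing).
Notation rF := 9 (only parsing).
Notation rM m := (10 + m) (only parsing).
Notation rI d := (13 + d.*2) (only parsing).
Notation rC d := (14 + d.*2) (only parsing).

Lemma upd_eq s k x : upd s k x k = x.
Proof. by rewrite /upd eqxx. Qed.

Lemma upd_ne s k x j : j != k -> upd s k x j = s j.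
Proof. by rewrite /upd => /negPf->. Qed.

Lemma updK s k x : s k = x -> upd s k x = s.
Proof. by move=> <-; store_eq. Qed.

(* The first [q] items of the list [es] held by stack [e] lie, reversed, on
   stack [rT]. *)
Definition pos e (es : seq (seq bool)) q s :=
  upd (upd s e (flatten (drop q es))) rT (rev (flatten (take q es))).

Definition advances (P : store -> Prop) e es c r U :=
  forall s q, P s -> q + r <= size es -> runs c (pos e es q s) U (pos e es (q + r) s).

Lemma posC e es q s k a z b : k != e -> k != rT -> z != e -> z != rT ->
  pos e es q (upd (upd s k a) z b) = upd (upd (pos e es q s) k a) z b.
Proof. by move=> *; rewrite /pos; store_eq. Qed.

Lemma advances_rep (P : store -> Prop) e es c r U k z m :
  k != z -> k != e -> k != rT -> z != e -> z != rT ->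
  (forall s a b, P s -> P (upd (upd s k a) z b)) ->
  advances P e es c r U ->
  advances (fun s => [/\ P s, s k = nseq m true & s z = [::]]) e es
    (rep k z c) (m * r) (m * (U + 10) + 2).
Proof.
move=> kz ke kT ze zT Pupd adv s q [Ps sk sz] qm.
apply: (@runs_rep k z c m U _ _ (fun i => pos e es (q + i * r) s)) => //.
- by rewrite /pos !upd_ne.
- by rewrite /pos !upd_ne.
- by rewrite addn0.
- by move=> i; rewrite /pos !upd_ne.
- by move=> i; rewrite /pos !upd_ne.
move=> i a b im; rewrite -!posC //; have -> : q + i.+1 * r = q + i * r + r by lia.
by apply: adv; [apply: Pupd | nia].
Qed.

(** In row-major order the item at [(a, b)] is preceded by [a] full rows and [b] more items. As
    [unit] passes one item, the same code walks over labels of varying length and over single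
    bits. *)
Definition seek (unit : prog) i j :=
  Seq (rep (rI i) rZ (rep rN rY unit)) (rep (rI j) rZ unit).

Definition seek_cost N U := N * (N * (U + 10) + 12) + 2 + (N * (U + 10) + 2).

Definition scratch_free (s : store) := (s rR = [::] /\ s rF = [::]) /\
  [/\ s rT = [::], s rZ = [::] & s rY = [::]].

Lemma runs_seek e es unit U n N a b i j s : rI i != e -> rI j != e -> e != rN ->
  e != rZ -> e != rY -> e != rT -> size es = n * n ->
  advances (fun s => s rR = [::] /\ s rF = [::]) e es unit 1 U ->
  scratch_free s -> s e = flatten es -> s rN = nseq n true ->
  s (rI i) = nseq a true -> s (rI j) = nseq b true -> a < n -> b < n -> n <= N ->
  runs (seek unit i j) s (seek_cost N U) (pos e es (a * n + b) s).
Proof.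
move=> ie je eN eZ eY eT sz adv [[sR sF] [sT sZ sY]] se sN si sj an bn nN.
have ? : n * n = (n - a).-1 * n + a * n + n by nia.
have adv1 : advances (fun s => [/\ s rR = [::] /\ s rF = [::], s rN = nseq n true & s rY = [::]])
  e es (rep rN rY unit) (n * 1) (n * (U + 10) + 2).
  by apply: advances_rep; rewrite // eq_sym.
have adv2 := @advances_rep _ e es _ _ _ (rI i) rZ a _ _ _ _ _ _ adv1.
have adv3 := @advances_rep _ e es _ _ _ (rI j) rZ b _ _ _ _ _ _ adv.
have s0 : pos e es 0 s = s.
  by rewrite /pos drop0 take0 /= (updK se) updK.
have r1 : runs (rep (rI i) rZ (rep rN rY unit)) s
    (a * (n * (U + 10) + 2 + 10) + 2) (pos e es (a * n) s).
  rewrite -{1}s0; have := adv2 _ _ _ _ _ _ s 0; rewrite add0n muln1; apply=> //.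
  - by rewrite eq_sym.
  - by rewrite sz; nia.
have r2 : runs (rep (rI j) rZ unit) (pos e es (a * n) s)
    (b * (U + 10) + 2) (pos e es (a * n + b) s).
  have := adv3 _ _ _ _ _ _ s (a * n); rewrite muln1; apply=> //.
  - by rewrite eq_sym.
  - by rewrite sz; nia.
apply: runs_le (runs_seq r1 r2) _; rewrite /seek_cost.
have ? : a * (n * (U + 10) + 2 + 10) <= N * (N * (U + 10) + 12).
  by apply: leq_mul; [lia | rewrite -addnA leq_add2r leq_mul2r nN orbT].
have ? : b * (U + 10) <= N * (U + 10) by apply: leq_mul; lia.
lia.
Qed.

Lemma runs_unseek e es q s : e != rT -> q <= size es ->
  s e = flatten es -> s rT = [::] ->
  runs (move rT e) (pos e es q s) (7 * size (flatten es) + 1) s.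
Proof.
move=> eT qs se sT.
have sz : size (pos e es q s rT) <= size (flatten es).
  rewrite /pos upd_eq size_rev -{2}(cat_take_drop q es) flatten_cat size_cat.
  by rewrite leq_addr.
apply: runs_le (runs_move _ _) _; [by rewrite eq_sym| |by lia].
rewrite /pos upd_eq upd_ne // upd_eq catrevE revK -flatten_cat cat_take_drop.
by store_eq.
Qed.

(** * Flat bit matrices, and reading one encoded graph entry *)

Definition mflat n (f : nat -> nat -> bool) : seq bool :=
  mkseq (fun q => f (q %/ n) (q %% n)) (n * n).

Definition singles (x : seq bool) : seq (seq bool) := [seq [:: b] | b <- x].

Lemma flatten_singles x : flatten (singles x) = x.
Proof. by elim: x => //= b x ->. Qed.

Lemma move1_advances e x (P : store -> Prop) : e != rT ->
  advances P e (singles x) (move1 e rT) 1 6.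
Proof.
move=> eT s q _ qx; rewrite addn1 in qx *.
have qs : q < size x by rewrite -(size_map (fun b => [:: b]) x).
rewrite /pos /singles -!map_take -!map_drop -!/(singles _) !flatten_singles.
apply: (@runs_move1 e rT (nth false x q) (drop q.+1 x)) => //.
  by rewrite upd_ne // upd_eq -drop_nth.
rewrite upd_eq (take_nth false) // rev_rcons.
by store_eq.
Qed.

Definition entry (o : option (seq bool)) : seq bool :=
  if o is Some bs then true :: flatten [seq [:: true; b] | b <- bs] ++ [:: false]
  else [:: false].

(** Digits are least significant first, so the extra leading bit turns a label [t] into [2 * t + 1]:
    edges get positive values in the order of their labels, and nonedges get 0. *)
Definition payload (o : option (seq bool)) : seq bool :=
  if o is Some bs then true :: bs else [::].

(** Digits arrive as pairs [1 b] closed by a single 0; [rF] stays nonempty until that 0 is met. *)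
Definition rd_body :=
   Case rE (Pop rF)
    (Seq (move1 rE rT)
         (Case rE Skip
            (Seq (Push rR true) (move1 rE rT))
            (Seq (Push rR false) (move1 rE rT))))
    (Seq (move1 rE rT) (Pop rF)).

Definition rd_loop := While rF rd_body.

Definition rd := Case rE Skip
  (Seq (Seq (move1 rE rT) (Seq (Push rR true) (Push rF true))) rd_loop)
  (move1 rE rT).

Lemma runs_rd_loop bs rest s s' :
  s rE = flatten [seq [:: true; b] | b <- bs] ++ false :: rest ->
  s rF = [:: true] ->
  upd (upd (upd (upd s rE rest) rT
      (false :: catrev (flatten [seq [:: true; b] | b <- bs]) (s rT)))
    rR (catrev bs (s rR))) rF [::] = s' ->
  runs rd_loop s (40 * size bs + 40) s'.
Proof.
elim: bs s s' => [|b bs IH] s s' /= sE sF <-.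
  have r : runs rd_body s (ev_cost rd_body)
     (upd (upd (upd s rE rest) rT (false :: s rT)) rF [::]).
    by apply: runs_ev => //=; rewrite sE /= /upd /= ?sE /= ?sF; store_eq.
  have r2 := runs_while_loop _ r (runs_while_stop _ _).
  by apply: runs_eq (runs_le (r2 _ _ _) _) _; rewrite ?sF //; store_eq.
set s1 := upd (upd (upd s rE (flatten [seq [:: true; b] | b <- bs] ++ false :: rest))
   rT (b :: true :: s rT)) rR (b :: s rR).
have r : runs rd_body s (ev_cost rd_body) s1.
  apply: runs_ev => //=; rewrite sE /= /upd /= ?sE /=.
  by rewrite /s1; case: b {s1 sE} => /=; rewrite /upd /=; store_eq.
have r2 := IH s1 _ erefl sF erefl.
have r3 := runs_while_loop _ r r2; rewrite sF in r3.
apply: runs_eq (runs_le (r3 _) _) _ => //; rewrite /s1 /=; last by store_eq.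
by lia.
Qed.

Lemma runs_rd o rest s s' : s rE = entry o ++ rest -> s rF = [::] ->
  upd (upd (upd s rE rest) rT (catrev (entry o) (s rT)))
    rR (catrev (payload o) (s rR)) = s' ->
  runs rd s (40 * size (entry o) + 100) s'.
Proof.
move=> sE sF <-; case: o sE => [bs|] /= sE; last first.
  have r : runs (move1 rE rT) s 6 (upd (upd s rE rest) rT (false :: s rT)).
    by apply: runs_move1 sE erefl.
  apply: (runs_eq (runs_le (runs_case _) _)); first by rewrite sE; exact: r.
    by lia.
  by rewrite (@updK _ rR).
have r1 : runs (Seq (move1 rE rT) (Seq (Push rR true) (Push rF true))) s
    (ev_cost (Seq (move1 rE rT) (Seq (Push rR true) (Push rF true))))
    (upd (upd (upd (upd s rE (behead (s rE))) rT (true :: s rT)) rR (true :: s rR))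
        rF [:: true]).
  by apply: runs_ev => //=; rewrite sE /= /upd /= sF; store_eq.
set s1 := upd _ rF _ in r1.
have sE1 : s1 rE = flatten [seq [:: true; b] | b <- bs] ++ false :: rest.
  by rewrite /s1 /upd /= sE -catA.
have r2 := runs_rd_loop sE1 (erefl (s1 rF)) erefl.
have szf : size bs <= size (flatten [seq [:: true; b] | b <- bs] ++ [:: false]).
  by elim: (bs) => //= b bs' IH; lia.
apply: (runs_eq (runs_le (runs_case _) _)); first by rewrite sE; exact: runs_seq r1 r2.
  by rewrite /=; lia.
rewrite /s1 !catrevE rev_cat /=.
by store_eq.
Qed.

(** * A loop language over bit matrices *)

Definition bval (x : seq bool) := foldr (fun (b : bool) v => b + v.*2) 0 x.

(** Comparison with the least significant digits read first: [acc] is the verdict on the digits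
    already read, which any difference further on overrides. *)
Definition bleq (acc : bool) x y := (bval x < bval y) || (bval x == bval y) && acc.

Lemma bleq_cons acc a b x y :
  bleq acc (a :: x) (b :: y) = bleq (if a == b then acc else b) x y.
Proof. by rewrite /bleq /=; case: a b acc => [] [] [] /=; lia. Qed.

Lemma bleq_consl acc a x : bleq acc (a :: x) [::] = bleq (~~ a && acc) x [::].
Proof. by rewrite /bleq /=; case: a acc => [] [] /=; lia. Qed.

Lemma bleq_consr acc b y : bleq acc [::] (b :: y) = bleq (b || acc) [::] y.
Proof. by rewrite /bleq /=; case: b acc => [] [] /=; lia. Qed.

Definition set_top k b := Seq (Pop k) (Push k b).

Definition cmp_body1 := Case rX Skip
  (Seq (Pop rX) (Case rW (set_top rV false) (Pop rW)
                   (Seq (Pop rW) (set_top rV false))))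
  (Seq (Pop rX) (Case rW Skip (Seq (Pop rW) (set_top rV true)) (Pop rW))).

Definition cmp_body2 := Case rW Skip (Seq (Pop rW) (set_top rV true)) (Pop rW).

Definition cmp := Seq (While rX cmp_body1) (While rW cmp_body2).

Lemma runs_cmp1 acc vs s : s rV = acc :: vs ->
  exists acc' y', [/\ runs (While rX cmp_body1) s (40 * size (s rX) + 1)
      (upd (upd (upd s rX [::]) rW y') rV (acc' :: vs)),
    bleq acc' [::] y' = bleq acc (s rX) (s rW) & size y' <= size (s rW)].
Proof.
move: {-1}(s rX) (erefl (s rX)) => x; elim: x acc s => [|a x IH] acc s sX sV.
  exists acc, (s rW); split=> //.
  by apply: runs_eq (runs_while_stop _ sX) _; store_eq.
pose acc' := if s rW is b :: y then (if a == b then acc else b) else ~~ a && acc.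
pose s1 := upd (upd (upd s rX x) rW (behead (s rW))) rV (acc' :: vs).
have r : runs cmp_body1 s (ev_cost cmp_body1) s1.
  apply: runs_ev => //=; rewrite sX /s1 /acc'.
  by case: a {acc' s1 sX} => /=; rewrite /upd /=; case E: (s rW) => [|[] w] /=;
    rewrite ?sV /=; store_eq.
have [acc2 [y' [r2 e2 sz]]] := IH acc' s1 erefl erefl.
exists acc2, y'; split.
- apply: runs_eq (runs_le (runs_while_loop _ r r2) _) _; rewrite ?sX //=; first by lia.
  by rewrite /s1; store_eq.
- by rewrite e2 /s1 /acc' /upd /=; case: (s rW) => [|b y] /=; rewrite ?bleq_cons ?bleq_consl.
- by apply: leq_trans sz _; rewrite /s1 /upd /= size_behead; lia.
Qed.

Lemma runs_cmp2 acc vs s : s rV = acc :: vs ->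
  runs (While rW cmp_body2) s (20 * size (s rW) + 1)
      (upd (upd s rW [::]) rV (bleq acc [::] (s rW) :: vs)).
Proof.
move: {-1}(s rW) (erefl (s rW)) => y; elim: y acc s => [|b y IH] acc s sW sV.
  by apply: runs_eq (runs_while_stop _ sW) _; rewrite /bleq /=; store_eq.
pose s1 := upd (upd s rW y) rV ((b || acc) :: vs).
have r : runs cmp_body2 s (ev_cost cmp_body2) s1.
  apply: runs_ev => //=; rewrite sW /s1.
  by case: b {s1 sW} => /=; rewrite /upd /= ?sV; store_eq.
apply: runs_eq (runs_le (runs_while_loop _ r (IH (b || acc) s1 erefl erefl)) _) _; rewrite ?sW //=; first by lia.
by rewrite bleq_consr /s1; store_eq.
Qed.

Lemma runs_cmp acc vs s s' : s rV = acc :: vs ->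
  upd (upd (upd s rX [::]) rW [::]) rV (bleq acc (s rX) (s rW) :: vs) = s' ->
  runs cmp s (40 * (size (s rX) + size (s rW)) + 2) s'.
Proof.
move=> sV <-; have [acc' [y' [r1 e sz]]] := runs_cmp1 sV.
have r2 := runs_cmp2 (erefl (upd (upd (upd s rX [::]) rW y') rV (acc' :: vs) rV)).
rewrite [in 20 * _]/upd /= in r2.
apply: runs_eq (runs_le (runs_seq r1 r2) _) _; first by lia.
by rewrite /upd /= e; store_eq.
Qed.

Definition unitE := Seq rd (clear rR).

Lemma idx_lt n a b : a < n -> b < n -> a * n + b < n * n.
Proof. nia. Qed.

Lemma size_mflat n f : size (mflat n f) = n * n.
Proof. by rewrite size_mkseq. Qed.

Lemma nth_mflat n f a b :
  a < n -> b < n -> nth false (mflat n f) (a * n + b) = f a b.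
Proof.
move=> an bn; rewrite nth_mkseq ?idx_lt // divnMDl; last by lia.
by rewrite modnMDl divn_small // modn_small // addn0.
Qed.

(** * Matrix expressions and commands, compiled to stack programs *)

Section Compile.
Variables (n N : nat) (os : seq (option (seq bool))).
Let es := map entry os.
Hypothesis size_os : size os = n * n.
Hypothesis leNes : size (flatten es) <= N.
Hypothesis leNn : n <= N.
Hypothesis leNnn : n * n <= N.

Let size_es : size es = n * n. Proof. by rewrite size_map. Qed.

Variable T : nat -> nat -> nat.
Hypothesis TE : forall i j, i < n -> j < n ->
  T i j = bval (payload (nth None os (i * n + j))).

Lemma runs_rd_pos q s s' : q < size es -> s rR = [::] -> s rF = [::] ->
  upd (pos rE es q.+1 s) rR (rev (payload (nth None os q))) = s' ->
  runs rd (pos rE es q s) (40 * N + 100) s'.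
Proof.
rewrite size_map => qs sR sF <-; set o := nth None os q.
have dq : drop q es = entry o :: drop q.+1 es.
  by rewrite (drop_nth [::]) ?size_map // (nth_map None).
have szo : size (entry o) <= N.
  by apply: leq_trans leNes; rewrite -(cat_take_drop q es) dq flatten_cat !size_cat /=; lia.
have r := @runs_rd o (flatten (drop q.+1 es)) (pos rE es q s).
apply: runs_le (r _ _ _ _) _; last by lia.
- by rewrite /pos upd_ne // upd_eq dq.
- by rewrite /pos !upd_ne.
rewrite /pos !(upd_eq, upd_ne) // sR !catrevE cats0.
rewrite (take_nth [::]) ?size_map // (nth_map None) // -/o -cats1 flatten_cat /= cats0 rev_cat.
by store_eq.
Qed.

Lemma size_payload q : size (payload (nth None os q)) <= N.
Proof.
have [qs|qs] := ltnP q (size os); last by rewrite nth_default.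
apply: leq_trans leNes; rewrite -(cat_take_drop q es).
rewrite (drop_nth [::]) ?size_map // (nth_map None) // flatten_cat size_cat /= size_cat.
have : size (payload (nth None os q)) <= size (entry (nth None os q)).
  by case: nth => //= bs; elim: bs => //= b bs; lia.
by lia.
Qed.

Lemma unitE_advances :
  advances (fun s => s rR = [::] /\ s rF = [::]) rE es unitE 1 (42 * N + 101).
Proof.
move=> s q [sR sF] qs; rewrite addn1 in qs *.
have r1 := runs_rd_pos qs sR sF erefl.
have r2 := runs_clear (k := rR) erefl; apply: runs_eq (runs_le (runs_seq r1 (r2 _)) _) _.
  by rewrite upd_eq size_rev; have := size_payload q; lia.
by rewrite /pos; store_eq.
Qed.

(** [rd] leaves the payload reversed on [rR]; the last move reverses it again, so that [cmp] finds
    the least significant bit on top. *)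
Definition load i j r :=
  Seq (Seq (seek unitE i j) rd) (Seq (move rT rE) (move rR r)).

Definition load_cost := seek_cost N (42 * N + 101) + (40 * N + 100) +
  ((7 * N + 1) + (7 * N + 1)).

Lemma runs_load i j a b r s s' : scratch_free s -> r \in [:: rX; rW] ->
  s rE = flatten es -> s rN = nseq n true -> s r = [::] ->
  s (rI i) = nseq a true -> s (rI j) = nseq b true -> a < n -> b < n ->
  upd s r (payload (nth None os (a * n + b))) = s' ->
  runs (load i j r) s load_cost s'.
Proof.
move=> sf rXW sE sN sr si sj an bn <-.
have [[sR sF] [sT sZ sY]] := sf.
have qs : a * n + b < size es by rewrite size_es; nia.
have r1 : runs (seek unitE i j) s (seek_cost N (42 * N + 101)) (pos rE es (a * n + b) s).
  by apply: runs_seek unitE_advances sf sE sN si sj an bn leNn.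
have r2 := runs_rd_pos qs sR sF erefl.
set p := payload _ in r2 *.
pose s1 := upd s rR (rev p).
have r3 : runs (move rT rE) (pos rE es (a * n + b).+1 s1) (7 * N + 1) s1.
  by apply: runs_le (runs_unseek _ _ _ _) _ => //; lia.
rewrite (_ : upd _ _ _ = pos rE es (a * n + b).+1 s1) in r2; last first.
  by rewrite /s1 /pos; store_eq.
have szp : size p <= N := size_payload _.
have r4 : runs (move rR r) s1 (7 * N + 1) (upd s r p).
  have rR' : rR != r by case/orP: rXW => [|/orP[|//]] => /eqP->.
  have rr' : (r == rR) = false by rewrite eq_sym; apply/negbTE.
  have s1R : s1 rR = rev p by rewrite /s1 upd_eq.
  have := @runs_move rR r s1 (upd s r p) rR'; rewrite s1R size_rev => h.
  apply: runs_le (h _) _; last by lia.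
  rewrite catrevE revK /s1 [X in p ++ X]upd_ne ?rr' // sr cats0.
  by store_eq.
exact: runs_seq (runs_seq r1 r2) (runs_seq r3 r4).
Qed.

(** The store layout between instructions inside [d] loops. It leaves [rV] unconstrained, because
    partial results pile up there. *)
Definition ready (d : nat) (env : nat -> nat) (st : nat -> nat -> nat -> bool) (s : store) :=
  [/\ scratch_free s, s rX = [::] /\ s rW = [::], s rE = flatten es /\ s rN = nseq n true,
      (forall m, m < 3 -> s (rM m) = mflat n (st m)) &
      (forall i, i < d -> s (rI i) = nseq (env i) true /\ env i < n)].

Inductive expr :=
| EMat (m i j : nat)
| ELe (i j k l : nat)
| ENot (e : expr)
| EAnd (e1 e2 : expr).

Fixpoint ewf d e :=
  match e with
  | EMat m i j => [&& m < 3, i < d & j < d]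
  | ELe i j k l => [&& i < d, j < d, k < d & l < d]
  | ENot e => ewf d e
  | EAnd e1 e2 => ewf d e1 && ewf d e2
  end.

Fixpoint esem e (env : nat -> nat) (st : nat -> nat -> nat -> bool) :=
  match e with
  | EMat m i j => st m (env i) (env j)
  | ELe i j k l => T (env i) (env j) <= T (env k) (env l)
  | ENot e => ~~ esem e env st
  | EAnd e1 e2 => esem e1 env st && esem e2 env st
  end.

Fixpoint ecomp e :=
  match e with
  | EMat m i j =>
    Seq (Seq (seek (move1 (rM m) rT) i j)
             (Case (rM m) Skip (Push rV true) (Push rV false)))
        (move rT (rM m))
  | ELe i j k l =>
    Seq (Seq (load i j rX) (load k l rW)) (Seq (Push rV true) cmp)
  | ENot e => Seq (ecomp e) (Case rV Skip (set_top rV false) (set_top rV true))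
  | EAnd e1 e2 =>
    Seq (Seq (ecomp e1) (ecomp e2))
        (Case rV Skip (Pop rV) (Seq (Pop rV) (set_top rV false)))
  end.

Fixpoint ecost e :=
  match e with
  | EMat m i j => seek_cost N 6 + 10 + (7 * N + 1)
  | ELe i j k l => load_cost + load_cost + (1 + (80 * N + 2))
  | ENot e => ecost e + 10
  | EAnd e1 e2 => ecost e1 + ecost e2 + 10
  end.

Lemma ready_updV d env st s v : ready d env st s -> ready d env st (upd s rV v).
Proof. by case. Qed.

Lemma runs_seek_mat d env st s m i j : ready d env st s ->
  [&& m < 3, i < d & j < d] ->
  runs (seek (move1 (rM m) rT) i j) s (seek_cost N 6)
    (pos (rM m) (singles (mflat n (st m))) (env i * n + env j) s).
Proof.
case=> sf _ [_ sN] sM sI /and3P[m3 id jd].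
have [[si ni] [sj nj]] := (sI _ id, sI _ jd).
apply: (runs_seek _ _ _ _ _ _ _ (@move1_advances _ _ _ _) sf _ sN si sj ni nj leNn);
  rewrite ?size_map ?size_mflat ?flatten_singles ?sM // ?size_iota; lia.
Qed.

Lemma runs_expr e d env st s s' : ewf d e -> ready d env st s ->
  upd s rV (esem e env st :: s rV) = s' -> runs (ecomp e) s (ecost e) s'.
Proof.
elim: e s s' => [m i j|i j k l|e IH|e1 IH1 e2 IH2] s s' wf rd <- /=.
- have r1 := runs_seek_mat rd wf; case: rd => -[_ [sT _ _]] _ _ sM sI.
  case/and3P: wf => m3 id jd; have [[si ni] [sj nj]] := (sI _ id, sI _ jd).
  set q := env i * n + _ in r1; set x := mflat _ _ in r1.
  have qx : q < size x by rewrite size_mflat; apply: idx_lt.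
  pose s1 := upd s rV (st m (env i) (env j) :: s rV).
  have r2 : runs (Case (rM m) Skip (Push rV true) (Push rV false))
     (pos (rM m) (singles x) q s) 10 (pos (rM m) (singles x) q s1).
    apply: runs_le (runs_ev _ _) _ => //=.
    rewrite {1}/pos upd_ne // upd_eq /singles -map_drop flatten_singles (drop_nth false qx).
    rewrite nth_mflat // /s1; case: (st m _ _); rewrite /pos; (rewrite !upd_ne; [|lia..]); by store_eq.
  apply: runs_seq (runs_seq r1 r2) _; apply: runs_le (runs_unseek _ _ _ _) _ => //.
  + by rewrite size_map; lia.
  + by rewrite flatten_singles /s1 upd_ne ?sM //; lia.
  + by rewrite flatten_singles size_mflat; lia.
- case: rd => sf [sX sW] [sE sN] sM sI; case/and4P: wf => id jd kd ld.
  have [[si ni] [sj nj]] := (sI _ id, sI _ jd).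
  have [[sk nk] [sl nl]] := (sI _ kd, sI _ ld).
  have r1 := runs_load sf (isT : rX \in [:: rX; rW]) sE sN sX si sj ni nj erefl.
  have r2 := @runs_load k l _ _ rW (upd s rX _) _ sf isT sE sN sW sk sl nk nl erefl.
  have {}r2 := runs_seq r1 (r2 _).
  apply: runs_seq r2 _.
  set s2 := upd _ _ _.
  (* The initial verdict [true] makes equal values compare as [<=]. *)
  have r3 : runs (Push rV true) s2 1 (upd s2 rV (true :: s2 rV)) by apply: (@runs_ev (Push _ _)).
  have r4 := runs_cmp (s := upd s2 rV (true :: s2 rV)) erefl erefl.
  apply: runs_eq (runs_le (runs_seq r3 r4) _) _.
    rewrite /s2 /upd /=.
    set q1 := _ + env j; set q2 := _ + env l.
    by have := size_payload q1; have := size_payload q2; lia.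
  by rewrite /s2 /upd /= /bleq andbT orbC -leq_eqVlt !TE //; store_eq.
- have r1 := IH s _ wf rd erefl.
  apply: runs_seq r1 _; apply: runs_le (runs_ev _ _) _ => //=.
  by rewrite upd_eq; case: (esem _ _ _) => /=; store_eq.
case/andP: wf => wf1 wf2.
have r1 := IH1 s _ wf1 rd erefl.
have r2 := IH2 _ _ wf2 (ready_updV (esem e1 env st :: s rV) rd) erefl.
apply: runs_seq (runs_seq r1 r2) _; apply: runs_le (runs_ev _ _) _ => //=.
rewrite !upd_eq; case: (esem e2 _ _) => /=; rewrite ?andbT ?andbF /upd /=; by store_eq.
Qed.


Definition bind (env : nat -> nat) d k := fun i => if i == d then k else env i.

Definition set_mat (st : nat -> nat -> nat -> bool) m i j b :=
  fun m' i' j' => if [&& m' == m, i' == i & j' == j] then b else st m' i' j'.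

Inductive cmd :=
| CSet (m i j : nat) (e : expr)
| CIf (e : expr) (c : cmd)
| CSeq (c1 c2 : cmd)
| CFor (c : cmd).

Fixpoint cwf d c :=
  match c with
  | CSet m i j e => [&& m < 3, i < d & j < d] && ewf d e
  | CIf e c => ewf d e && cwf d c
  | CSeq c1 c2 => cwf d c1 && cwf d c2
  | CFor c => cwf d.+1 c
  end.

(* Index variables are de Bruijn levels: a loop at depth [d] binds [d]. *)
Fixpoint csem d c env st :=
  match c with
  | CSet m i j e => set_mat st m (env i) (env j) (esem e env st)
  | CIf e c => if esem e env st then csem d c env st else st
  | CSeq c1 c2 => csem d c2 env (csem d c1 env st)
  | CFor c => foldl (fun st k => csem d.+1 c (bind env d k) st) st (iota 0 n)
  end.

(** In a loop [rC d] counts down while the index [rI d] counts up from zero, so the body meets the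
    indices in the order of [iota 0 n]. *)
Fixpoint ccomp d c :=
  match c with
  | CSet m i j e =>
    Seq (Seq (ecomp e) (seek (move1 (rM m) rT) i j))
      (Seq (Case rV Skip (Seq (Pop rV) (set_top (rM m) true))
                         (Seq (Pop rV) (set_top (rM m) false)))
           (move rT (rM m)))
  | CIf e c => Seq (ecomp e) (Case rV Skip (Seq (Pop rV) (ccomp d c)) (Pop rV))
  | CSeq c1 c2 => Seq (ccomp d c1) (ccomp d c2)
  | CFor c =>
    Seq (rep rN rZ (Push (rC d) true))
      (Seq (While (rC d) (Seq (ccomp d.+1 c) (Seq (Pop (rC d)) (Push (rI d) true))))
           (clear (rI d)))
  end.

Fixpoint ccost c :=
  match c with
  | CSet m i j e => ecost e + seek_cost N 6 + (20 + (7 * N + 1))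
  | CIf e c => ecost e + (ccost c + 5)
  | CSeq c1 c2 => ccost c1 + ccost c2
  | CFor c => (N * 11 + 2) + ((N * (ccost c + 2).+1 + 1) + (2 * N + 1))
  end.

(** Stacks 10 to 12 hold the three matrices. A command restores all other stacks, so this
    overwriting describes its whole effect. *)
Definition put_mats (s : store) (st : nat -> nat -> nat -> bool) : store :=
  fun r => if 10 <= r < 13 then mflat n (st (r - 10)) else s r.

Lemma put_mats_id d env st s : ready d env st s -> put_mats s st = s.
Proof.
case=> _ _ _ sM _; apply: functional_extensionality => r; rewrite /put_mats.
case: ifP => // h; rewrite -sM; last by lia.
by congr s; lia.
Qed.

Lemma ready_put_mats d env st st' s :
  ready d env st s -> ready d env st' (put_mats s st').
Proof.
case=> sf h1 h2 sM sI; split=> //.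
by move=> m m3; rewrite /put_mats ifT ?addKn //; lia.
Qed.

Lemma put_matsI s st d : put_mats s st (rI d) = s (rI d). Proof. by []. Qed.

Lemma put_matsC s st d : put_mats s st (rC d) = s (rC d). Proof. by []. Qed.

Lemma put_matsK s st st' : put_mats (put_mats s st) st' = put_mats s st'.
Proof. by apply: functional_extensionality => r; rewrite /put_mats; case: (_ && _). Qed.

Lemma mflat_set (f : nat -> nat -> bool) a b v : a < n -> b < n ->
  take (a * n + b) (mflat n f) ++ v :: drop (a * n + b).+1 (mflat n f) =
  mflat n (fun i j => if (i == a) && (j == b) then v else f i j).
Proof.
move=> an bn; have qn := idx_lt an bn; set q := _ + b in qn *.
have sz : size (take q (mflat n f)) = q by rewrite size_takel // size_mflat ltnW.
apply: (@eq_from_nth _ false) => [|i].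
  by rewrite size_cat sz /= size_drop !size_mflat; lia.
rewrite size_cat sz /= size_drop size_mflat => hi.
have ilt : i < n * n by lia.
rewrite nth_cat sz [RHS]nth_mkseq //.
have n0 : 0 < n by lia.
have E : (i %/ n == a) && (i %% n == b) = (i == q).
  apply/andP/eqP => [[/eqP ia /eqP ib]|->]; first by rewrite (divn_eq i n) ia ib.
  by rewrite divnMDl // modnMDl divn_small // modn_small // addn0.
rewrite E; have [iq|iq] := ltnP i q.
  rewrite nth_take // nth_mkseq // ltn_eqF //.
case: (i =P q) => [->|ne]; first by rewrite subnn.
have -> : i - q = (i - q.+1).+1 by lia.
by rewrite /= nth_drop nth_mkseq; [rewrite subnKC //; lia | lia].
Qed.

Lemma flatten_drop_singles q x : flatten (drop q (singles x)) = drop q x.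
Proof. by rewrite -map_drop -/(singles _) flatten_singles. Qed.

Lemma flatten_take_singles q x : flatten (take q (singles x)) = take q x.
Proof. by rewrite -map_take -/(singles _) flatten_singles. Qed.

Lemma runs_set_top v vs k b x s : rV != k -> s rV = v :: vs -> s k = b :: x ->
  runs (Case rV Skip (Seq (Pop rV) (set_top k true)) (Seq (Pop rV) (set_top k false)))
    s 20 (upd (upd s rV vs) k (v :: x)).
Proof.
move=> Vk sV sk; apply: runs_le (runs_ev _ _) _ => //=; rewrite sV.
by case: v {sV} => /=; rewrite [upd s rV _ k]upd_ne 1?eq_sym // sk /=; store_eq.
Qed.

(** A loop has to find its counter and index stacks empty, which is the hypothesis on depths from
    [d] on. The conclusion alters only the matrices, so the hypothesis holds again for the next
    command. *)
Lemma runs_cmd c d env st s s' : cwf d c -> ready d env st s ->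
  (forall i, d <= i -> s (rI i) = [::] /\ s (rC i) = [::]) ->
  put_mats s (csem d c env st) = s' -> runs (ccomp d c) s (ccost c) s'.
Proof.
elim: c d env st s s' => [m i j e|e c IH|c1 IH1 c2 IH2|c IH] d env st s s' /= wf rd loc <-.
- case/andP: wf => mij wfe.
  have r1 := runs_expr wfe rd erefl; set v := esem _ _ _ in r1 *.
  have rd1 := ready_updV (v :: s rV) rd.
  have r2 := runs_seek_mat rd1 mij.
  case: (rd) => -[_ [sT _ _]] _ _ sM sI.
  case/and3P: mij => m3 id jd; have [[si ni] [sj nj]] := (sI _ id, sI _ jd).
  set q := env i * n + _ in r2; set x := mflat _ _ in r2.
  have qx : q < size x by rewrite size_mflat; apply: idx_lt.
  pose y := take q x ++ v :: drop q.+1 x.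
  have sz : size y = size x.
    by rewrite /y size_cat /= size_takel ?size_drop; lia.
  have ey : y = mflat n (set_mat st m (env i) (env j) v m).
    by rewrite /y mflat_set //; apply: eq_mkseq => k; rewrite /set_mat eqxx.
  pose s2 := upd s (rM m) y.
  have r3 : runs (Case rV Skip (Seq (Pop rV) (set_top (rM m) true))
                         (Seq (Pop rV) (set_top (rM m) false)))
     (pos (rM m) (singles x) q (upd s rV (v :: s rV))) 20 (pos (rM m) (singles y) q s2).
    have Vm : rV != rM m by lia.
    have pM : pos (rM m) (singles x) q (upd s rV (v :: s rV)) (rM m)
      = nth false x q :: drop q.+1 x.
      by rewrite /pos upd_ne // upd_eq flatten_drop_singles -drop_nth.
    have pV : pos (rM m) (singles x) q (upd s rV (v :: s rV)) rV = v :: s rV.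
      by rewrite /pos upd_ne // upd_ne // upd_eq.
    apply: runs_eq (runs_set_top Vm pV pM) _.
    rewrite /pos !flatten_take_singles !flatten_drop_singles /s2 /y.
    rewrite take_size_cat ?drop_size_cat ?size_takel 1?ltnW //.
    by store_eq.
  have r4 : runs (move rT (rM m)) (pos (rM m) (singles y) q s2) (7 * N + 1) s2.
    apply: runs_le (runs_unseek _ _ _ _) _ => //.
    + by rewrite size_map sz ltnW.
    + by rewrite flatten_singles /s2 upd_eq.
    + by rewrite flatten_singles sz size_mflat; lia.
  apply: runs_eq (runs_seq (runs_seq r1 r2) (runs_seq r3 r4)) _.
  rewrite /s2; apply: functional_extensionality => r; rewrite /upd /put_mats.
  case: eqP => [->|ne]; first by rewrite ifT ?addKn //; lia.
  case: ifP => // h; have -> : s r = mflat n (st (r - 10)) by rewrite -sM; [congr s|]; lia.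
  by apply: eq_mkseq => k; rewrite /set_mat ifF //; lia.
- case/andP: wf => wfe wfc.
  have r1 := runs_expr wfe rd erefl; apply: runs_seq r1 _.
  have rp : runs (Pop rV) (upd s rV (esem e env st :: s rV)) 1 s.
    by apply: (@runs_ev (Pop _)) => //=; store_eq.
  apply: runs_le (runs_case (T := ccost c + 4) _) _; last by lia.
  rewrite upd_eq; case: (esem e env st) rp => rp.
    by apply: runs_le (runs_seq rp (IH _ _ _ _ _ wfc rd loc erefl)) _; lia.
  by rewrite (put_mats_id rd); apply: runs_le rp _; lia.
- case/andP: wf => wf1 wf2; have r1 := IH1 _ _ _ _ _ wf1 rd loc erefl.
  have rd1 := ready_put_mats (csem d c1 env st) rd.
  apply: runs_seq r1 _; apply: IH2 wf2 rd1 _ _.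
    exact: loc.
  by rewrite put_matsK.
have [sf h1 [sE sN] sM sI] := rd; have [sId sCd] := loc d (leqnn d).
have [_ [sT sZ sY]] := sf.
set st' := foldl _ _ _.
have r1 : runs (rep rN rZ (Push (rC d) true)) s (n * 11 + 2) (upd s (rC d) (nseq n true)).
  apply: (@runs_rep rN rZ _ n 1 _ _ (fun i => upd s (rC d) (nseq i true))) => //.
    by rewrite updK.
  move=> i a b _; apply: (@runs_ev (Push _ _)) => //=.
  by rewrite upd_ne // upd_ne // upd_eq; store_eq.
pose sts k := foldl (fun st k => csem d.+1 c (bind env d k) st) st (iota 0 k).
pose S k := put_mats (upd (upd s (rC d) (nseq (n - k) true)) (rI d) (nseq k true)) (sts k).
have r2 : runs (While (rC d) (Seq (ccomp d.+1 c) (Seq (Pop (rC d)) (Push (rI d) true))))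
   (S 0) (n * (ccost c + 2).+1 + 1) (S n).
  apply: runs_while => [k kn|].
    2: by rewrite /S put_matsC upd_ne ?upd_eq ?subnn //; lia.
  split.
    by rewrite /S put_matsC upd_ne ?upd_eq -?size_eq0 ?size_nseq; lia.
  have rdk : ready d.+1 (bind env d k) (sts k) (S k).
    split=> //.
      by move=> m m3; rewrite /S /put_mats ifT ?addKn //; lia.
    move=> i; rewrite ltnS leq_eqVlt /bind /S put_matsI.
    case: eqP => [-> _|ne /= id]; first by rewrite upd_eq.
    by rewrite !upd_ne; [exact: sI|lia|lia].
  have lock i : d.+1 <= i -> S k (rI i) = [::] /\ S k (rC i) = [::].
    move=> di; rewrite /S put_matsI put_matsC; have [|? ?] := loc i; first by lia.
    by rewrite !upd_ne //; lia.
  apply: runs_seq (IH _ _ _ _ _ wf rdk lock erefl) _.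
  apply: (@runs_ev (Seq _ _)) => //=.
  have -> : csem d.+1 c (bind env d k) (sts k) = sts k.+1.
    by rewrite /sts -(addn1 k) iotaD foldl_cat.
  have -> : put_mats (S k) (sts k.+1) (rC d) = nseq (n - k) true.
    by rewrite put_matsC /S put_matsC upd_ne ?upd_eq //; lia.
  rewrite [upd _ (rC d) _ (rI d)]upd_ne; last by lia.
  rewrite put_matsI {2}/S put_matsI upd_eq.
  apply: functional_extensionality => r; rewrite /S /upd /put_mats.
  have -> : n - k = (n - k.+1).+1 by lia.
  case: (r =P rI d) => [->|?] //=; case: (r =P rC d) => [->|?] //=.
  by case: (10 <= r < 13).
have r3 : runs (clear (rI d)) (S n) (2 * n + 1) (put_mats s st').
  have SI : S n (rI d) = nseq n true by rewrite /S put_matsI upd_eq.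
  have := @runs_clear (rI d) (S n) (put_mats s st'); rewrite SI size_nseq; apply.
  apply: functional_extensionality => r; rewrite /S /upd /put_mats subnn.
  case: (r =P rI d) => [->|?]; first by rewrite sId.
  by case: (_ && _) => //; case: (r =P rC d) => [->|//].
have e0 : upd s (rC d) (nseq n true) = S 0.
  rewrite /S subn0 -(put_mats_id rd); apply: functional_extensionality => r.
  rewrite /upd /put_mats; case: (r =P rC d) => [->|?].
    by rewrite ifF //; lia.
  case: (r =P rI d) => [->|?]; first by rewrite sId.
  by case: (_ && _).
rewrite e0 in r1; apply: runs_le (runs_seq r1 (runs_seq r2 r3)) _.
by have := leq_mul leNn (leqnn (ccost c + 2).+1); lia.
Qed.

End Compile.

(** * The algorithm *)

(** The language has no constants; comparing a weight with itself supplies one. *)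
Definition eTrue i := ELe i i i i.
Definition eOr e1 e2 := ENot (EAnd (ENot e1) (ENot e2)).
Definition eLt i j k l := ENot (ELe k l i j).
Definition eEq i j k l := EAnd (ELe i j k l) (ELe k l i j).
(* Nonedges, in particular [(i, i)], have weight 0. *)
Definition ePos i j := eLt i i i j.

Definition eForb a v b x :=
  eOr (EAnd (EAnd (ePos a v) (ELe a v v b)) (eLt a b v b))
    (EAnd (ePos a v) (EAnd (eEq v b a v) (EAnd (eEq a b a v) (EAnd (eLt a v x v)
      (EAnd (EAnd (ePos x a) (ELe x a a v)) (eLt x b a v)))))).

(* Matrix 0 is the orientation built so far, matrix 1 a tentative extension of
   it, and the entry of matrix 2 at the current pair tells whether the matrix
   examined last contains an edge in both directions. *)
Definition cCopy m1 m2 d := CFor (CFor (CSet m2 d d.+1 (EMat m1 d d.+1))).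

(** The indices 4, 5, 6, 7 stand for [a], [v], [b], [x]; the two assignments apply the two
    implications of the forbidden path [a -> v -> b]. *)
Definition cStep := CIf (eForb 4 5 6 7)
  (CSeq (CSet 1 6 5 (eOr (EMat 1 6 5) (EMat 1 4 5)))
        (CSet 1 5 4 (eOr (EMat 1 5 4) (EMat 1 5 6)))).

Definition cRound := CFor (CFor (CFor (CFor cStep))).

(** The two loops merely count: [n * n] rounds suffice, since a path of implications without
    repetition visits at most [n * n] pairs. *)
Definition cClose := CFor (CFor cRound).

Definition cAdjoin i j :=
  CSeq (cCopy 0 1 2) (CSeq (CSet 1 i j (eTrue 0)) cClose).

Definition cConflict m := CSeq (CSet 2 0 1 (ENot (eTrue 0)))
  (CFor (CFor (CSet 2 0 1 (eOr (EMat 2 0 1) (EAnd (EMat m 2 3) (EMat m 3 2)))))).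

Definition cChoose :=
  CIf (EAnd (ePos 0 1) (EAnd (ENot (EMat 0 0 1)) (ENot (EMat 0 1 0))))
    (CSeq (CSeq (cAdjoin 0 1) (cConflict 1))
          (CSeq (CIf (EMat 2 0 1) (cAdjoin 1 0)) (cCopy 1 0 2))).

(** [cConflict] writes at the current pair. Running it at every pair puts the final verdict into all
    of matrix 2, in particular into the entry on top of its stack. *)
Definition cMain := CSeq (CFor (CFor cChoose)) (CFor (CFor (cConflict 0))).

Lemma cwf_main : cwf 0 cMain. Proof. by []. Qed.

(** * What the commands compute: saturation under [step] and the greedy choice *)

Section Sem.
Variables (n : nat) (T : nat -> nat -> nat).
Hypothesis Tsym : forall i j, T i j = T j i.
Hypothesis Tirr : forall i, T i i = 0.
Local Notation mats := (nat -> nat -> nat -> bool).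
Local Notation sem := (csem n T).

Lemma sem_for (P : nat -> mats -> Prop) d c env st :
  P 0 st -> (forall k st', k < n -> P k st' -> P k.+1 (sem d.+1 c (bind env d k) st')) ->
  P n (sem d (CFor c) env st).
Proof.
move=> P0 PS /=.
suff: forall k, k <= n -> P k (foldl (fun st k => sem d.+1 c (bind env d k) st) st (iota 0 k)).
  by apply.
elim=> [|k IH] kn //; rewrite -(addn1 k) iotaD foldl_cat /= addn1.
by apply: PS => //; apply: IH; apply: ltnW.
Qed.

Lemma esem_or e1 e2 env st :
  esem T (eOr e1 e2) env st = esem T e1 env st || esem T e2 env st.
Proof. by rewrite /= negb_and !negbK. Qed.

Lemma esem_pos i j env st : esem T (ePos i j) env st = (0 < T (env i) (env j)).
Proof. by rewrite /= Tirr ltnNge. Qed.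

Lemma sem_set d m i j e env st : sem d (CSet m i j e) env st =
  set_mat st m (env i) (env j) (esem T e env st).
Proof. by []. Qed.

Lemma sem_copy m1 m2 d env st m i j : m1 != m2 ->
  sem d (cCopy m1 m2 d) env st m i j =
    if [&& m == m2, i < n & j < n] then st m1 i j else st m i j.
Proof.
move=> /eqP m12.
apply: (sem_for (P := fun k st' => forall m i j, st' m i j =
  if [&& m == m2, i < k & j < n] then st m1 i j else st m i j)).
  by move=> m' i' j'; rewrite andbF.
move=> k st1 kn h1.
have := @sem_for (fun l st' => forall m i j, st' m i j =
  if (m == m2) && ((i < k) && (j < n) || (i == k) && (j < l)) then st m1 i j else st m i j).
move=> H m' i' j'; rewrite (H d.+1 (CSet m2 d d.+1 (EMat m1 d d.+1)) (bind env d k) st1).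
- by congr (if _ then _ else _); case: (m' == m2) => //=; lia.
- by move=> m3 i3 j3; rewrite h1; congr (if _ then _ else _); lia.
move=> l st2 ln h2 m3 i3 j3 /=; rewrite /set_mat /bind eqxx.
have -> : (d == d.+1) = false by lia.
rewrite eqxx; case: ifP => [/and3P[/eqP-> /eqP-> /eqP->]|ne].
  rewrite h2; have -> : (m1 == m2) = false by apply/eqP.
  by rewrite ifT //= eqxx; lia.
by rewrite h2; congr (if _ then _ else _); lia.
Qed.

Lemma sem_conflict m env st m' i j : m < 2 -> env 0 < n -> env 1 < n ->
  sem 2 (cConflict m) env st m' i j =
    if [&& m' == 2, i == env 0 & j == env 1]
    then [exists p : 'I_n * 'I_n, st m p.1 p.2 && st m p.2 p.1] else st m' i j.
Proof.
move=> m2 e0 e1.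
pose st1 := set_mat st 2 (env 0) (env 1) (~~ (T (env 0) (env 0) <= T (env 0) (env 0))).
(* The pairs inspected, in lexicographic order, before the loops reach [(k, l)]. *)
pose hit k l (p : 'I_n * 'I_n) := (p.1 < k) || (p.1 == k :> nat) && (p.2 < l).
pose Q k l (st' : mats) := forall m' i j, st' m' i j =
  if [&& m' == 2, i == env 0 & j == env 1]
    then [exists p : 'I_n * 'I_n, hit k l p && (st m p.1 p.2 && st m p.2 p.1)] else st m' i j.
have -> : [exists p : 'I_n * 'I_n, st m p.1 p.2 && st m p.2 p.1] =
  [exists p : 'I_n * 'I_n, hit n 0 p && (st m p.1 p.2 && st m p.2 p.1)].
  by apply: eq_existsb => p; rewrite /hit ltn_ord.
move: m' i j.
suff : Q n 0 (sem 2 (CFor (CFor (CSet 2 0 1 (eOr (EMat 2 0 1) (EAnd (EMat m 2 3) (EMat m 3 2)))))) env st1) by [].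
apply: (sem_for (P := fun k => Q k 0)).
  move=> m' i j; rewrite /st1 /set_mat leqnn.
  case: [&& _, _ & _] => //.
  by apply/esym/negbTE/existsP => -[p]; rewrite /hit !ltn0 !andbF.
move=> k st2 kn h2.
have -> : Q k.+1 0 = Q k n.
  have E : hit k.+1 0 = hit k n.
    apply: functional_extensionality => p.
    by rewrite /hit ltn0 andbF orbF ltn_ord andbT ltnS leq_eqVlt orbC.
  by rewrite /Q E.
apply: (sem_for (P := Q k)) => // l st3 ln h3 m' i j.
have -> : sem 4 (CSet 2 0 1 (eOr (EMat 2 0 1) (EAnd (EMat m 2 3) (EMat m 3 2))))
    (bind (bind env 2 k) 3 l) st3 =
  set_mat st3 2 (env 0) (env 1) (st3 2 (env 0) (env 1) || st3 m k l && st3 m l k).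
  by rewrite sem_set esem_or.
rewrite /set_mat; case: ifP => [_|ne]; last first.
  by rewrite h3 ne.
rewrite !h3 !eqxx /=.
have -> : (m == 2) = false by lia.
apply/orP/existsP => [[/existsP[p /andP[h ?]]|h]|[p /andP[h H]]].
- by exists p; rewrite /hit in h *; apply/andP; split=> //; lia.
- by exists (Ordinal kn, Ordinal ln); rewrite /hit /= eqxx ltnSn orbT.
have [h'|h'] := boolP (hit k l p); first by left; apply/existsP; exists p; rewrite h'.
right; case: p h h' H => a b; rewrite /hit /= => h h'.
by have [-> ->] : k = a /\ l = b by lia.
Qed.

Definition wt (a b : 'I_n) := T a b.
Local Notation step := (step wt).

Definition matp (st : mats) m : pred ('I_n * 'I_n) := fun p => st m p.1 p.2.

(** Sound growth of matrix 1. The last clause says that only consequences of its old contents were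
    added, in a form that composes without counting steps. *)
Definition extends (st st' : mats) :=
  [/\ forall m i j, m != 1 -> st' m i j = st m i j,
      forall p, matp st 1 p -> matp st' 1 p &
      forall X : pred ('I_n * 'I_n), (forall e f, X e -> step e f -> X f) ->
        (forall p, matp st 1 p -> X p) -> forall p, matp st' 1 p -> X p].

Lemma extends_trans st2 st1 st3 : extends st1 st2 -> extends st2 st3 -> extends st1 st3.
Proof.
case=> h1 h2 h3 [h4 h5 h6]; split=> [m i j m1|p /h2 /h5 //|X Xcl X1].
  by rewrite h4 ?h1.
by apply: h6 => //; apply: h3.
Qed.

Lemma extends_for d c env st :
  (forall k st', k < n -> extends st' (sem d.+1 c (bind env d k) st')) ->
  extends st (sem d (CFor c) env st).
Proof.
move=> h; apply: (sem_for (P := fun _ => extends st)) => // k st' kn h'.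
exact: extends_trans h' (h k st' kn).
Qed.

(** The completeness counterpart of [extends_for]: what iteration [k] achieves survives the later
    ones, as they only extend the matrix. *)
Lemma reach_for k (U : mats -> Prop) d c env st : k < n ->
  (forall st1 st2, extends st1 st2 -> U st1 -> U st2) ->
  (forall k st', k < n -> extends st' (sem d.+1 c (bind env d k) st')) ->
  (forall st', extends st st' -> U (sem d.+1 c (bind env d k) st')) ->
  U (sem d (CFor c) env st).
Proof.
move=> kn Umono hQ hU.
have [_] : extends st (sem d (CFor c) env st) /\ (k < n -> U (sem d (CFor c) env st)).
  apply: (sem_for (P := fun i st' => extends st st' /\ (k < i -> U st'))) => // i st' ilt [h1 h2].
  split; first exact: extends_trans h1 (hQ _ _ ilt).
  rewrite ltnS leq_eqVlt => /orP[/eqP <-|ki]; first exact: hU.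
  by apply: Umono (hQ _ _ ilt) _; apply: h2.
exact.
Qed.

Lemma extends_set st e f : step e f ->
  let st' := set_mat st 1 f.1 f.2 (st 1 f.1 f.2 || st 1 e.1 e.2) in
  extends st st' /\ (matp st 1 e -> matp st' 1 f).
Proof.
move=> ef; split; last by rewrite /matp /set_mat !eqxx => ->; rewrite orbT.
split=> [m i j /negPf m1|p|X Xcl X1 p]; rewrite /matp /set_mat ?m1 //.
  by case: ifP => // /and3P[_ /eqP-> /eqP->] ->.
case: ifP => [/and3P[_ /eqP h1 /eqP h2]|_]; last exact: X1.
have -> : p = f by case: (p) (f) h1 h2 => [a b] [c d] /= /val_inj -> /val_inj ->.
by case/orP=> [/X1 //|/X1 /Xcl]; apply.
Qed.

Lemma esem_forb (env : nat -> nat) st (a v b x : 'I_n) :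
  env 4 = a -> env 5 = v -> env 6 = b -> env 7 = x ->
  esem T (eForb 4 5 6 7) env st = forbP wt a v b || forbL wt a v b x.
Proof.
move=> e4 e5 e6 e7; rewrite /eForb esem_or /forbP /forbL /wt.
by congr orb; rewrite /= !Tirr -!ltnNge ?(e4, e5, e6, e7) ?eqn_leq // !andbA.
Qed.

Lemma extends_step env st : env 4 < n -> env 5 < n -> env 6 < n -> env 7 < n ->
  extends st (sem 8 cStep env st).
Proof.
move=> h4 h5 h6 h7; rewrite /cStep.
pose a := Ordinal h4; pose v := Ordinal h5; pose b := Ordinal h6; pose x := Ordinal h7.
rewrite [sem _ _ _ _](_ : _ = if esem T (eForb 4 5 6 7) env st then
   sem 8 (CSet 1 5 4 (eOr (EMat 1 5 4) (EMat 1 5 6))) env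
     (sem 8 (CSet 1 6 5 (eOr (EMat 1 6 5) (EMat 1 4 5))) env st) else st) //.
rewrite (@esem_forb env st a v b x) //; case: ifP => // fb.
have fb' : forb wt a v b by apply/existsP; exists x.
have s1 : step (a, v) (b, v) by rewrite /step /= eqxx fb'.
have s2 : step (v, b) (v, a) by rewrite /step /= eqxx fb' orbT.
rewrite !sem_set !esem_or.
exact: extends_trans (extends_set st s1).1 (extends_set _ s2).1.
Qed.

Lemma step_step (env : nat -> nat) st (a v b x : 'I_n) e f :
  env 4 = a -> env 5 = v -> env 6 = b -> env 7 = x ->
  forbP wt a v b || forbL wt a v b x ->
  e = (a, v) /\ f = (b, v) \/ e = (v, b) /\ f = (v, a) ->
  matp st 1 e -> matp (sem 8 cStep env st) 1 f.
Proof.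
move=> e4 e5 e6 e7 fb ef se.
rewrite [sem _ _ _ _](_ : _ = if esem T (eForb 4 5 6 7) env st then
   sem 8 (CSet 1 5 4 (eOr (EMat 1 5 4) (EMat 1 5 6))) env
     (sem 8 (CSet 1 6 5 (eOr (EMat 1 6 5) (EMat 1 4 5))) env st) else st) //.
rewrite (esem_forb _ e4 e5 e6 e7) fb.
have fb' : forb wt a v b by apply/existsP; exists x.
have s1 : step (a, v) (b, v) by rewrite /step /= eqxx fb'.
have s2 : step (v, b) (v, a) by rewrite /step /= eqxx fb' orbT.
rewrite !sem_set !esem_or /= e4 e5 e6.
have [x1 r1] := extends_set st s1; have [x2 r2] := extends_set (set_mat st 1 b v (st 1 b v || st 1 a v)) s2.
case: ef se => -[-> ->] se.
  by case: x2 => _ + _; apply; apply: r1.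
by apply: r2; case: x1 => _ + _; apply.
Qed.

Lemma extends_round env st : extends st (sem 4 cRound env st).
Proof. by do 4!apply: extends_for => ? ? ?; apply: extends_step. Qed.

(** Among the four nested loops, single out the iteration at a forbidden path that justifies the
    step. Earlier iterations preserve [e], later ones preserve [f]. *)
Lemma round_step env st e f : matp st 1 e -> step e f ->
  matp (sem 4 cRound env st) 1 f.
Proof.
move=> se ef.
have [a [v [b [x [fb aef]]]]] : exists a v b x, forbP wt a v b || forbL wt a v b x /\
    (e = (a, v) /\ f = (b, v) \/ e = (v, b) /\ f = (v, a)).
  case: e f ef {se} => [e1 e2] [f1 f2] /orP[] /andP[/= /eqP-> /existsP[x fb]].
    by exists e1, e2, f1, x; split=> //; left.
  by exists f2, e1, e2, x; split=> //; right.
pose U (st' : mats) := matp st' 1 f.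
have [an vn bn xn] := And4 (ltn_ord a) (ltn_ord v) (ltn_ord b) (ltn_ord x).
have Um st1 st2 : extends st1 st2 -> U st1 -> U st2 by case=> _ + _; apply.
change (U (sem 4 cRound env st)); rewrite /cRound.
apply: (@reach_for a U) => // [? ? ?|st1 x1]; 
  first by do 3!apply: extends_for => ? ? ?; apply: extends_step => //=; rewrite /bind /=.
apply: (@reach_for v U) => // [? ? ?|st2 x2]; 
  first by do 2!apply: extends_for => ? ? ?; apply: extends_step => //=; rewrite /bind /=.
apply: (@reach_for b U) => // [? ? ?|st3 x3]; 
  first by apply: extends_for => ? ? ?; apply: extends_step => //=; rewrite /bind /=.
apply: (@reach_for x U) => // [? ? ?|st4 x4]; first by apply: extends_step => //=; rewrite /bind /=.
apply: (step_step (a := a) (v := v) (b := b) (x := x) _ _ _ _ fb aef) => //.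
by have [_ + _] := extends_trans (extends_trans x1 x2) (extends_trans x3 x4); apply.
Qed.

(** Soundness takes for the closed set of [extends] the pairs reachable from the old matrix.
    Completeness shortens the path of implications and charges one round to each of its steps. *)
Lemma sem_close env st :
  let st' := sem 2 cClose env st in
  (forall m i j, m != 1 -> st' m i j = st m i j) /\
  (forall p, matp st' 1 p <-> exists2 e, matp st 1 e & connect step e p).
Proof.
move=> st'.
have [x1 x2 x3] : extends st st'.
  by do 2!apply: extends_for => ? ? ?; apply: extends_round.
split=> // p; split.
  pose X : pred ('I_n * 'I_n) := fun p => [exists e, matp st 1 e && connect step e p].
  move=> /(x3 X) h; have: X p.
    apply: h => [e f /existsP[g /andP[g1 g2]] ef|q q1].
      by apply/existsP; exists g; rewrite g1 (connect_trans g2 (connect1 ef)).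
    by apply/existsP; exists q; rewrite q1 connect0.
  by case/existsP=> e /andP[? ?]; exists e.
case=> e se /connectP[q0 /shortenP[q eq uq _] ->].
have szq : size q <= n * n.
  have := max_card (mem (e :: q)); rewrite (card_uniqP uq) card_prod card_ord /=.
  exact: ltnW.
pose R t (st' : mats) := forall e q, path step e q -> size q <= t -> matp st 1 e ->
  matp st' 1 (last e q).
suff: R (n * n + 0) st' by apply=> //; rewrite addn0.
rewrite addn0; apply: (sem_for (P := fun k => R (k * n))).
  by move=> e' [].
move=> k st1 kn R1; rewrite mulSn addnC.
apply: (sem_for (P := fun l => R (k * n + l))); first by rewrite addn0.
move=> l st2 ln R2 e' q'; case/lastP: q' => [_ _ se'|q' f].
  have [_ + _] := extends_round (bind (bind env 2 k) 3 l) st2; apply.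
  by apply: (R2 e' [::]).
rewrite rcons_path size_rcons last_rcons addnS ltnS => /andP[pq' lf] sq se'.
by apply: round_step lf; apply: R2.
Qed.

(** Since matrix 0 is already closed, saturating its copy together with [(a, b)] adds just the
    consequences of [(a, b)]. *)
Lemma sem_adjoin i j env st (a b : 'I_n) : env i = a :> nat -> env j = b :> nat ->
  (forall e f, matp st 0 e -> step e f -> matp st 0 f) ->
  let st' := sem 2 (cAdjoin i j) env st in
  (forall m k l, m != 1 -> st' m k l = st m k l) /\
  matp st' 1 = adjoin wt (matp st 0) (a, b).
Proof.
move=> ea eb cl st'.
pose st1 := sem 2 (cCopy 0 1 2) env st.
pose st2 := set_mat st1 1 a b true.
have h1 m k l : st1 m k l = if [&& m == 1, k < n & l < n] then st 0 k l else st m k l.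
  exact: sem_copy.
have -> : st' = sem 2 cClose env st2.
  (* The bit [true] is rewritten backwards into the value of [eTrue 0], after which both sides agree
     by computation. *)
  by rewrite /st2 -ea -eb -(leqnn (T (env 0) (env 0))).
have [h3 h4] := sem_close env st2.
split=> [m k l m1|].
  by rewrite h3 // /st2 /set_mat (negPf m1) h1 (negPf m1).
apply: functional_extensionality => p; rewrite /adjoin.
have st2E e : matp st2 1 e = (e == (a, b)) || matp st 0 e.
  case: e => e1 e2; rewrite /matp /st2 /set_mat /= h1 !ltn_ord /= xpair_eqE -!val_eqE /=.
  by case: (_ && _).
apply/idP/orP => [/h4[e]|H].
  rewrite st2E => /orP[/eqP-> |e0 ep]; [by right|left].
  exact: (forward_connect cl e0 ep).
apply/h4; case: H => [p0|ep]; [exists p | exists (a, b)]; rewrite ?st2E ?p0 ?eqxx ?orbT //.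
Qed.

Lemma sem_choose (env : nat -> nat) st (a b : 'I_n) : env 0 = a -> env 1 = b ->
  (forall e f, matp st 0 e -> step e f -> matp st 0 f) ->
  matp (sem 2 cChoose env st) 0 = choose_at wt (matp st 0) (a, b).
Proof.
move=> ea eb cl.
rewrite [choose_at _ _ _](_ : _ =
  if [&& 0 < wt a b, ~~ matp st 0 (a, b) & ~~ matp st 0 (b, a)] then
    if conflict (adjoin wt (matp st 0) (a, b)) then adjoin wt (matp st 0) (b, a)
    else adjoin wt (matp st 0) (a, b)
  else matp st 0) //.
pose st1 := sem 2 (cAdjoin 0 1) env st.
pose st2 := sem 2 (cConflict 1) env st1.
pose st3 := sem 2 (cAdjoin 1 0) env st2.
pose st4 := if st2 2 a b then st3 else st2.
have -> : sem 2 cChoose env st =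
  if [&& 0 < wt a b, ~~ matp st 0 (a, b) & ~~ matp st 0 (b, a)] then
    sem 2 (cCopy 1 0 2) env st4 else st.
  rewrite /st4 /st3 /st2 /st1 /wt /matp -ea -eb.
  by rewrite -(esem_pos 0 1 env st).
have [k1 adj1] := sem_adjoin ea eb cl; rewrite -/st1 in k1 adj1.
have A1 : matp st1 0 = matp st 0.
  by apply: functional_extensionality => p; rewrite /matp k1.
have h2 := @sem_conflict 1 env st1; rewrite -/st2 ea eb in h2.
have A2 : matp st2 0 = matp st 0.
  by apply: functional_extensionality => p; rewrite /matp h2 //= k1.
have B2 : matp st2 1 = adjoin wt (matp st 0) (a, b).
  by rewrite -adj1; apply: functional_extensionality => p; rewrite /matp h2.
have C2 : st2 2 a b = conflict (adjoin wt (matp st 0) (a, b)).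
  by rewrite h2 // !eqxx -adj1.
have cl2 : forall e f, matp st2 0 e -> step e f -> matp st2 0 f by rewrite A2.
have [k3 adj3] := sem_adjoin eb ea cl2; rewrite -/st3 A2 in k3 adj3.
case: ifP => // _; rewrite [matp _ 0](_ : _ = matp st4 1).
  by rewrite /st4 C2; case: ifP.
by apply: functional_extensionality => p; rewrite /matp sem_copy // !ltn_ord.
Qed.

Lemma sem_main env : exists A : pred ('I_n * 'I_n),
  let st := sem 0 cMain env (fun _ _ _ => false) in
  [/\ greedy_inv wt n 0 A, matp st 0 = A & forall i j, i < n -> j < n -> st 2 i j = conflict A].
Proof.
pose st0 : mats := fun _ _ _ => false.
pose st1 := sem 0 (CFor (CFor cChoose)) env st0.
have wtsym a b : wt a b = wt b a by apply: Tsym.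
have inv1 : greedy_inv wt n 0 (matp st1 0).
  apply: (sem_for (P := fun i st => greedy_inv wt i 0 (matp st 0))); first exact: greedy_inv0.
  move=> i st ilt invi; apply: greedy_inv_row.
  apply: (sem_for (P := fun j st => greedy_inv wt i j (matp st 0))) => // j st' jlt invj.
  rewrite (@sem_choose _ _ (Ordinal ilt) (Ordinal jlt)) //; last by case: invj.
  exact: (greedy_inv_choose wtsym (i := Ordinal ilt) (j := Ordinal jlt)).
exists (matp st1 0) => st.
have stE : st = sem 0 (CFor (CFor (cConflict 0))) env st1 by [].
split=> //; rewrite stE.
  apply: (sem_for (P := fun _ st => matp st 0 = matp st1 0)) => // i st' ilt <-.
  apply: (sem_for (P := fun _ st => matp st 0 = matp st' 0)) => // j st2 jlt <-.
  by apply: functional_extensionality => p; rewrite /matp sem_conflict.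
pose Q i j (st : mats) := matp st 0 = matp st1 0 /\
  forall k l, k < i \/ k = i /\ l < j -> l < n -> st 2 k l = conflict (matp st1 0).
suff [_ h] : Q n 0 (sem 0 (CFor (CFor (cConflict 0))) env st1) by move=> i j ilt jlt; apply: h => //; left.
apply: (sem_for (P := fun i => Q i 0)); first by split=> // k l [|[]].
move=> i st' ilt [h1 h2].
suff [h3 h4] : Q i n (sem 1 (CFor (cConflict 0)) (bind env 0 i) st').
  split=> // k l [|[]//]; rewrite ltnS leq_eqVlt => /orP[/eqP ki|ki] ln; apply: h4 => //.
    by right.
  by left.
apply: (sem_for (P := Q i)); first by split=> // k l h; apply: h2; case: h => [|[]//]; left.
move=> j st2 jlt [h3 h4]; split=> [|k l kl ln].
  by rewrite -h3; apply: functional_extensionality => p; rewrite /matp sem_conflict.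
rewrite sem_conflict // -h3.
rewrite (_ : bind (bind env 0 i) 1 j 0 = i) // (_ : bind (bind env 0 i) 1 j 1 = j) //.
case: ifP => [_ //|ne]; rewrite h3; apply: h4 => //.
by case: kl => [|[ki lj]]; [left|right; split=> //; move: ne; rewrite ki eqxx /=; lia].
Qed.

End Sem.

(** * Parsing, allocation, output, and the complete program *)

Definition parse_body :=
  Case rE (Pop rF) (Seq (Pop rE) (Push rN true)) (Seq (Pop rE) (Pop rF)).

Definition parse := Seq (Push rF true) (While rF parse_body).

Lemma runs_parse n rest s' :
  upd (upd (fun _ => [::]) rE rest) rN (nseq n true) = s' ->
  runs parse (input_store (nseq n true ++ false :: rest)) (20 * n + 30) s'.
Proof.
move=> <-.
have loop k j s : s rF = [:: true] -> s rE = nseq k true ++ false :: rest ->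
    s rN = nseq j true ->
    runs (While rF parse_body) s (20 * k + 20)
      (upd (upd (upd s rF [::]) rE rest) rN (nseq (k + j) true)).
  elim: k j s => [|k IH] j s sF sE sN.
    have r : runs parse_body s (ev_cost parse_body) (upd (upd s rF [::]) rE rest).
      by apply: runs_ev => //=; rewrite sE /= /upd /= sF; store_eq.
    have r2 := runs_while_loop _ r (runs_while_stop _ _).
    by apply: runs_eq (runs_le (r2 _ _ _) _) _; rewrite ?sF //= /upd /= -sN; store_eq.
  pose s1 := upd (upd s rE (nseq k true ++ false :: rest)) rN (nseq j.+1 true).
  have r : runs parse_body s (ev_cost parse_body) s1.
    by apply: runs_ev => //=; rewrite sE /= /s1 /upd /= sN; store_eq.
  have r2 := runs_while_loop _ r (IH j.+1 s1 sF erefl erefl).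
  apply: runs_eq (runs_le (r2 _) _) _; rewrite ?sF //=; first by lia.
  by rewrite /s1 addnS; store_eq.
have r1 : runs (Push rF true) (input_store (nseq n true ++ false :: rest)) 1
    (upd (input_store (nseq n true ++ false :: rest)) rF [:: true]).
  by apply: (@runs_ev (Push _ _)).
have r2 : runs (While rF parse_body) _ (20 * n + 20) _ :=
  loop n 0 (upd (input_store (nseq n true ++ false :: rest)) rF [:: true]) erefl erefl erefl.
apply: runs_eq (runs_le (runs_seq r1 r2) _) _; first by lia.
by rewrite addn0 /input_store; store_eq.
Qed.

(** The vertex count is first copied to [rX]: an outer counter is partly consumed while the inner
    loop runs, so the two loops cannot share one stack. *)
Definition alloc m := Seq (rep rN rZ (Push rX true))
  (Seq (rep rX rZ (rep rN rY (Push (rM m) false))) (clear rX)).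

Lemma runs_alloc m n s s' : s rN = nseq n true ->
  [/\ s rZ = [::], s rY = [::], s rX = [::] & s (rM m) = [::]] ->
  upd s (rM m) (nseq (n * n) false) = s' ->
  runs (alloc m) s (n * (n * 11 + 12) + 13 * n + 5) s'.
Proof.
move=> sN [sZ sY sX sM] <-.
have push k b q z s1 : k != rN -> k != z -> z != rN -> s1 rN = nseq n true ->
    s1 z = [::] -> s1 k = nseq q b ->
    runs (rep rN z (Push k b)) s1 (n * 11 + 2) (upd s1 k (nseq (n + q) b)).
  move=> kN kz zN s1N s1z s1k.
  apply: (@runs_rep rN z _ n 1 _ _ (fun i => upd s1 k (nseq (i + q) b))) => //.
  - by rewrite eq_sym.
  - by rewrite updK.
  - by move=> i; rewrite upd_ne // eq_sym.
  - by move=> i; rewrite upd_ne // eq_sym.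
  move=> i a c _; apply: (@runs_ev (Push _ _)) => //=.
  by rewrite upd_ne // upd_ne // upd_eq; store_eq.
pose s1 := upd s rX (nseq n true).
have r1 : runs (rep rN rZ (Push rX true)) s (n * 11 + 2) s1.
  by apply: runs_eq (push rX true 0 _ _ _ _ _ _ _ _) _; rewrite // addn0.
have r2 : runs (rep rX rZ (rep rN rY (Push (rM m) false))) s1
   (n * (n * 11 + 12) + 2) (upd s1 (rM m) (nseq (n * n) false)).
  apply: runs_le (@runs_rep rX rZ _ n (n * 11 + 2) _ _
    (fun i => upd s1 (rM m) (nseq (i * n) false)) _ _ _ _ _ _ _ _) _ => //; last by lia.
    by rewrite updK.
  move=> i a b ilt; apply: runs_eq (push (rM m) false (i * n) _ _ _ _ _ _ _ _) _ => //.
    by rewrite upd_ne // upd_ne // upd_eq.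
  by rewrite mulSn; store_eq.
have r3 := runs_clear (k := rX) (s := upd s1 (rM m) (nseq (n * n) false)) erefl.
rewrite (_ : upd s1 _ _ rX = nseq n true) // size_nseq in r3.
apply: runs_eq (runs_le (runs_seq r1 (runs_seq r2 r3)) _) _; first by lia.
by rewrite /s1; store_eq.
Qed.

Definition emit := Seq (move (rM 0) rT) (Seq (move rT rE) (Push rE true)).

(** Matrix 2 is an empty stack exactly when there are no vertices; the empty orientation is then a
    correct answer. The two moves in [emit] reverse twice and so keep the row-major order. *)
Definition answer := Seq (clear rE) (Case (rM 2) emit (Push rE false) emit).

Lemma runs_answer N s : size (s rE) <= N -> size (s (rM 0)) <= N -> s rT = [::] ->
  exists2 s', runs answer s (16 * N + 10) s' &
    s' rE = if head false (s (rM 2)) then [:: false] else true :: s (rM 0).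
Proof.
move=> szE szM sT; pose s1 := upd s rE [::].
have r1 : runs (clear rE) s (2 * N + 1) s1 by apply: runs_le (runs_clear erefl) _; lia.
pose s2 := upd (upd s1 (rM 0) [::]) rT (rev (s (rM 0))).
pose s3 := upd (upd s2 rT [::]) rE (s (rM 0)).
have r2 : runs emit s1 (14 * N + 3)
   (upd s3 rE (true :: s (rM 0))).
  have ra : runs (move (rM 0) rT) s1 (7 * N + 1) s2.
    apply: runs_le (runs_move _ _) _ => //; last by rewrite /s1 upd_ne //; lia.
    by rewrite /s2 /s1 !upd_ne // sT catrevE cats0.
  have rb : runs (move rT rE) s2 (7 * N + 1) s3.
    apply: runs_le (runs_move _ _) _ => //; last by rewrite /s2 upd_eq size_rev; lia.
    by rewrite /s3 /s2 /s1 upd_eq /upd /= catrevE revK cats0.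
  have rc : runs (Push rE true) s3 1 (upd s3 rE (true :: s (rM 0))) by apply: (@runs_ev (Push _ _)).
  by apply: runs_le (runs_seq ra (runs_seq rb rc)) _; lia.
have rf : runs (Push rE false) s1 1 (upd s1 rE [:: false]) by apply: (@runs_ev (Push _ _)).
have M2 : s1 (rM 2) = s (rM 2) by [].
have rcase b s4 : head false (s (rM 2)) = b ->
    runs (if b then Push rE false else emit) s1 (14 * N + 3) s4 -> runs answer s (16 * N + 10) s4.
  move=> hb r3; have r4 : runs (Case (rM 2) emit (Push rE false) emit) s1 (14 * N + 4) s4.
    apply: runs_le (runs_case (T := 14 * N + 3) _) _; last by lia.
    by rewrite M2; case: (s (rM 2)) hb => [|[] x] /= hb; rewrite -hb in r3.
  by apply: runs_le (runs_seq r1 r4) _; lia.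
case E : (head _ _).
  by exists (upd s1 rE [:: false]) => //; apply: (rcase true) => //; apply: runs_le rf _; lia.
by exists (upd s3 rE (true :: s (rM 0))) => //; apply: (rcase false).
Qed.

Definition tto_prog := Seq (Seq parse (Seq (alloc 0) (Seq (alloc 1) (alloc 2))))
  (Seq (ccomp 0 cMain) answer).

Definition tto_cost N :=
  20 * N + 30 + 3 * (N * (N * 11 + 12) + 13 * N + 5) + ccost N cMain + (16 * N + 10).

Lemma runs_tto n os (T : nat -> nat -> nat) x :
  (forall i j, T i j = T j i) -> (forall i, T i i = 0) ->
  size os = n * n -> x = nseq n true ++ false :: flatten (map entry os) ->
  (forall i j, i < n -> j < n -> T i j = bval (payload (nth None os (i * n + j)))) ->
  exists f : nat -> nat -> bool,
    let A := fun p : 'I_n * 'I_n => f p.1 p.2 in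
    greedy_inv (@wt n T) n 0 A /\
    exists2 s', runs tto_prog (input_store x) (tto_cost (size x)) s' &
      s' rE = if conflict A then [:: false] else true :: mflat n f.
Proof.
move=> Tsym Tirr szos xE TE; set N := size x.
have leNes : size (flatten (map entry os)) <= N.
  by rewrite /N xE size_cat /= size_nseq; lia.
have leNn : n <= N by rewrite /N xE size_cat size_nseq leq_addr.
have leNnn : n * n <= N.
  apply: leq_trans leNes; rewrite -szos; elim: (os) => //= o os' IH.
  by rewrite size_cat; case: o => [bs|] /=; lia.
pose E := flatten (map entry os); pose F := nseq (n * n) false.
pose s1 := upd (upd (fun _ => [::]) rE E) rN (nseq n true).
pose s2 := upd s1 (rM 0) F; pose s3 := upd s2 (rM 1) F; pose s4 := upd s3 (rM 2) F.
pose st0 : nat -> nat -> nat -> bool := fun _ _ _ => false.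
have r1 : runs parse (input_store x) (20 * n + 30) s1 by rewrite xE; apply: runs_parse.
have r2 : runs (alloc 0) s1 _ s2 := runs_alloc erefl (And4 erefl erefl erefl erefl) erefl.
have r3 : runs (alloc 1) s2 _ s3 := runs_alloc erefl (And4 erefl erefl erefl erefl) erefl.
have r4 : runs (alloc 2) s3 _ s4 := runs_alloc erefl (And4 erefl erefl erefl erefl) erefl.
have FE : F = mflat n (fun _ _ => false).
  apply: (@eq_from_nth _ false); first by rewrite size_nseq size_mflat.
  by move=> i; rewrite size_nseq => h; rewrite nth_nseq h nth_mkseq.
have rd : ready n os 0 (fun=> 0) st0 s4.
  split=> // m m3; rewrite -FE /s4 /s3 /s2 /upd.
  by case: m m3 => [|[|[]]].
have r5 := runs_cmd szos leNes leNn leNnn TE (T := T) cwf_main rd _ erefl.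
set st := csem n T 0 cMain (fun=> 0) st0 in r5.
have {}r5 := r5 (fun _ _ => conj erefl erefl).
have [A [invA AE confA]] := sem_main n Tsym Tirr (fun=> 0).
exists (st 0) => A'; have AA : A' = A by rewrite -AE.
rewrite AA; split=> //.
have szM : size (put_mats n s4 st (rM 0)) <= N by rewrite size_mflat.
have [s5 r6 sE] := @runs_answer N (put_mats n s4 st) leNes szM erefl.
have : runs tto_prog (input_store x) (tto_cost N) s5.
  apply: runs_le (runs_seq (runs_seq r1 (runs_seq r2 (runs_seq r3 r4))) (runs_seq r5 r6)) _.
  rewrite /tto_cost; have := leq_mul leNn (leq_add (leq_mul leNn (leqnn 11)) (leqnn 12)).
  by lia.
exists s5 => //; rewrite sE.
have -> : put_mats n s4 st (rM 2) = mflat n (st 2) by [].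
have -> // : head false (mflat n (st 2)) = conflict A.
(* Without vertices [head] falls back to [false], in agreement with the absence of any pair that
   could conflict. *)
case: (posnP n) => [n0|n0].
  have -> : mflat n (st 2) = [::] by apply: size0nil; rewrite size_mflat n0.
  by apply/esym/existsP => -[p _]; have := ltn_ord p.1; rewrite [X in _ < X]n0.
rewrite -nth0 nth_mkseq ?muln_gt0 ?n0 //.
by rewrite div0n mod0n; apply: confA.
Qed.

(** * Polynomial bounds on the cost functions *)

Definition poly_bounded (f : nat -> nat) := exists p : {poly nat}, forall N, f N <= p.[N]%R.

Lemma poly_bounded_const c : poly_bounded (fun=> c).
Proof. by exists (polyC c) => N; rewrite hornerC. Qed.

Lemma poly_bounded_id : poly_bounded id.
Proof. by exists 'X%R => N; rewrite hornerX. Qed.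

Lemma poly_bounded_add f g :
  poly_bounded f -> poly_bounded g -> poly_bounded (fun N => f N + g N).
Proof. by case=> p hp [q hq]; exists (p + q)%R => N; rewrite hornerD leq_add. Qed.

Lemma poly_bounded_mul f g :
  poly_bounded f -> poly_bounded g -> poly_bounded (fun N => f N * g N).
Proof. by case=> p hp [q hq]; exists (p * q)%R => N; rewrite hornerM leq_mul. Qed.

Lemma poly_bounded_S f : poly_bounded f -> poly_bounded (fun N => (f N).+1).
Proof.
move=> /(poly_bounded_add (poly_bounded_const 1)) [p hp].
by exists p => N; rewrite -add1n.
Qed.

Ltac poly_bound := rewrite /seek_cost /load_cost; repeat first
  [ assumption | exact: poly_bounded_const | exact: poly_bounded_id
  | apply: poly_bounded_S | apply: poly_bounded_add | apply: poly_bounded_mul ].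

Lemma poly_bounded_ecost e : poly_bounded (ecost^~ e).
Proof. by elim: e => [m i j|i j k l|e IH|e1 IH1 e2 IH2] /=; poly_bound. Qed.

Lemma poly_bounded_ccost c : poly_bounded (ccost^~ c).
Proof.
by elim: c => [m i j e|e c IH|c1 IH1 c2 IH2|c IH] /=;
  try have He := poly_bounded_ecost e; poly_bound.
Qed.

Lemma poly_bounded_tto : poly_bounded tto_cost.
Proof. by rewrite /tto_cost; have h := poly_bounded_ccost cMain; poly_bound. Qed.

(** * Instances *)

Lemma nth_allpairs (S T R : Type) (f : S -> T -> R) x0 y0 z0 s t i j :
  i < size s -> j < size t ->
  nth z0 [seq f u v | u <- s, v <- t] (i * size t + j) = f (nth x0 s i) (nth y0 t j).
Proof.
elim: s i => [|a s IH] [|i] //= ilt jlt; rewrite nth_cat size_map.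
  by rewrite jlt (nth_map y0).
by rewrite mulSn -addnA ltnNge leq_addr /= addKn IH.
Qed.

(** By induction, the first [k] binary digits of [u] have value [u %% 2 ^ k]; [bits] takes enough
    digits for the remainder to be the number itself. *)
Lemma bval_bits t : bval (bits t) = t.
Proof.
have gen k u : bval (mkseq (fun i => odd (u %/ 2 ^ i)) k) = u %% 2 ^ k.
  elim: k u => [|k IH] u; first by rewrite modn1.
  rewrite /mkseq /= expn0 divn1 (iotaDl 1 0) -map_comp.
  rewrite (@eq_map _ _ _ (fun i => odd (u %/ 2 %/ 2 ^ i))); last first.
    by move=> i; rewrite /= add1n expnS divnMA.
  have := IH (u %/ 2); rewrite /mkseq => ->; rewrite expnS divn2.
  have m0 : 0 < 2 ^ k by rewrite expn_gt0.
  rewrite [in RHS](_ : u = (u./2 %/ 2 ^ k) * (2 * 2 ^ k) + (odd u + (u./2 %% 2 ^ k).*2)).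
    rewrite modnMDl [RHS]modn_small //.
    by have := ltn_pmod u./2 m0; move: (2 ^ k) (u./2 %% 2 ^ k) => m r; case: (odd u) => /=; lia.
  rewrite -{1}(odd_double_half u) {1}(divn_eq u./2 (2 ^ k)).
  by move: (u./2 %/ 2 ^ k) (u./2 %% 2 ^ k) => q r; nia.
rewrite /bits gen modn_small //.
exact: (@up_logP 2 t.+1 isT).
Qed.

Section Instance.
Variable G : temporal_graph.
Let V := vertex G.
Let n := #|V|.
Let ev : 'I_n -> V := enum_val.
Implicit Types u v w : V.

Lemma enum_pairs (R : Type) z0 (f : V -> V -> R) (a b : 'I_n) :
  nth z0 [seq f u v | u <- enum V, v <- enum V] (a * n + b) = f (ev a) (ev b).
Proof.
have := @nth_allpairs V V R f (ev a) (ev b) z0 (enum V) (enum V) a b.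
by rewrite -cardE -!enum_val_nth => ->.
Qed.

Definition entry_at u v := if adj u v then Some (bits (time u v)) else None.

Definition edge_weight u v := if adj u v then (time u v).*2.+1 else 0.

(** Extended by 0 to indices out of range, which makes symmetry and the zero diagonal hold for all
    natural numbers. *)
Definition weight (i j : nat) : nat :=
  match insub i : option 'I_n, insub j : option 'I_n with
  | Some a, Some b => edge_weight (ev a) (ev b)
  | _, _ => 0
  end.

Lemma adjC u v : adj u v = adj v u. Proof. by rewrite /adj setUC. Qed.

Lemma timeC u v : time u v = time v u. Proof. by rewrite /time setUC. Qed.

Lemma adj_irr u : adj u u = false.
Proof. by apply/negP => /edges_card2; rewrite setUid cards1. Qed.

Lemma weightC i j : weight i j = weight j i.
Proof.
rewrite /weight; case: insub => [a|]; case: insub => [b|] //.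
by rewrite /edge_weight adjC timeC.
Qed.

Lemma weight_irr i : weight i i = 0.
Proof. by rewrite /weight; case: insub => [a|] //; rewrite /edge_weight adj_irr. Qed.

Lemma wt_weight (a b : 'I_n) : wt weight a b = edge_weight (ev a) (ev b).
Proof. by rewrite /wt /weight !valK. Qed.

Lemma edge_weight_gt0 u v : (0 < edge_weight u v) = adj u v.
Proof. by rewrite /edge_weight; case: ifP. Qed.

Lemma leq_edge_weight u v u' v' : adj u v -> adj u' v' ->
  (edge_weight u v <= edge_weight u' v') = (time u v <= time u' v').
Proof. by rewrite /edge_weight => -> ->; rewrite ltnS leq_double. Qed.

Definition orientation_of (A : pred ('I_n * 'I_n)) : {set V * V} :=
  [set p | A (enum_rank p.1, enum_rank p.2)].

Lemma tt_orientation_of A : tt_set (@wt n weight) A -> tt_orientation (orientation_of A).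
Proof.
case=> Aadj Ax Att.
have wr u v : wt weight (enum_rank u) (enum_rank v) = edge_weight u v.
  by rewrite wt_weight /ev !enum_rankK.
have FA u v : (u, v) \in orientation_of A -> adj u v.
  by rewrite inE => /Aadj; rewrite wr edge_weight_gt0.
split; first split=> // u v; first by rewrite -edge_weight_gt0 -wr !inE; apply: Ax.
move=> u v w uv vw h; have [auv avw] := (FA _ _ uv, FA _ _ vw).
move: uv vw; rewrite !inE /= => uv vw.
have [|uw hw] := Att _ _ _ uv vw; first by rewrite !wr leq_edge_weight.
split=> //; rewrite -leq_edge_weight -?wr //.
by rewrite -edge_weight_gt0 -wr Aadj.
Qed.

Lemma tt_set_of F : tt_orientation F ->
  tt_set (@wt n weight) (fun p => (ev p.1, ev p.2) \in F).
Proof.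
case=> -[Fadj Fx] Ftt; split=> [a b /Fadj|a b|a v b av vb].
- by rewrite wt_weight edge_weight_gt0.
- by rewrite wt_weight edge_weight_gt0 => /Fx.
rewrite !wt_weight leq_edge_weight ?Fadj // => h.
by have [ab hb] := Ftt _ _ _ av vb h; split=> //; rewrite leq_edge_weight ?Fadj.
Qed.

Lemma enc_orientation_of (f : nat -> nat -> bool) :
  enc_orientation (orientation_of (fun p => f p.1 p.2)) = mflat n f.
Proof.
rewrite /enc_orientation; apply: (@eq_from_nth _ false) => [|q].
  by rewrite size_allpairs -cardE size_mflat.
rewrite size_allpairs -cardE => qlt.
have n0 : 0 < n by move: qlt; rewrite -/n; case: (posnP n) => // ->.
have qn : q %/ n < n by rewrite ltn_divLR.
pose a := Ordinal qn; pose b := Ordinal (ltn_pmod q n0).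
have -> : q = a * n + b by rewrite /= -divn_eq.
by rewrite enum_pairs nth_mflat // inE /ev !enum_valK.
Qed.

Lemma tto_correct : exists y s',
  [/\ runs tto_prog (input_store (enc_graph G)) (tto_cost (size (enc_graph G))) s',
      s' 0 = y & TTO_search G y].
Proof.
pose os := [seq entry_at u v | u <- enum V, v <- enum V].
have szos : size os = n * n by rewrite size_allpairs -cardE.
have xE : enc_graph G = nseq n true ++ false :: flatten (map entry os).
  rewrite /enc_graph /os map_allpairs; congr (_ ++ _ :: flatten _).
  by apply: eq_allpairs => u v; rewrite /enc_entry /entry_at; case: ifP.
have TE i j : i < n -> j < n -> weight i j = bval (payload (nth None os (i * n + j))).
  move=> ilt jlt; have := enum_pairs None entry_at (Ordinal ilt) (Ordinal jlt).
  rewrite /= => ->; have := wt_weight (Ordinal ilt) (Ordinal jlt).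
  rewrite /wt /= => ->; rewrite /edge_weight /entry_at; case: ifP => // _.
  by rewrite /= bval_bits.
have [f [inv [s' r sE]]] := runs_tto weightC weight_irr szos xE TE.
exists (s' 0), s'; split=> //; rewrite {}sE.
have [hno hyes] := greedy_inv_end (fun a b => weightC a b) inv.
case: ifP hno hyes => cf hno hyes.
  right; split=> // -[F ttF]; exact: (hno isT _ (tt_set_of ttF)).
left; exists (orientation_of (fun p => f p.1 p.2)).
  by apply: tt_orientation_of; apply: hyes.
by rewrite enc_orientation_of.
Qed.

End Instance.

(** * From search to decision *)

Lemma exec_size c s t s' k : exec c s t s' -> size (s' k) <= size (s k) + t.
Proof.
elim=> {c s t s'} [s|j b s|j s|c1 c2 s1 s2 s3 t1 t2 _ h1 _ h2|j c0 c1 c2 s s' t _ h|j c s _|j c s1 s2 s3 t1 t2 _ _ h1 _ h2];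
  rewrite /upd; try case: eqP => [->|_]; rewrite /= ?size_behead; lia.
Qed.

(** The first bit of the search output is the decision; the rest is erased, in time proportional to
    its length, which the running time of the search bounds. *)
Lemma search_decidable (I : Type) (enc : I -> seq bool) (Q : I -> Prop)
    (correct : I -> seq bool -> Prop) :
  (forall i y, correct i y -> exists2 b, head false y = b & b <-> Q i) ->
  (forall i y, correct i y -> y != [::]) ->
  polytime_solvable enc correct -> polytime_decidable enc Q.
Proof.
move=> hQ hne [c [p hc]].
exists (Seq c (Case 0 Skip (Seq (clear 0) (Push 0 true)) (Seq (clear 0) (Push 0 false)))).
(* By [exec_size] the output has length at most ['X + p], and clearing a stack costs twice its size
   plus one. *)
exists (p + ((2%N)%:P * ('X + p) + (10%N)%:P))%R => i.
have [y [t [s [ex tp sy]]] cy] := hc i.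
have [b hb bQ] := hQ _ _ cy.
exists [:: b]; last by exists b.
have szy : size (s 0) <= size (enc i) + p.[size (enc i)]%R.
  by apply: leq_trans (exec_size 0 ex) _; rewrite leq_add2l.
have rc : runs (Seq (clear 0) (Push 0 b)) s (2 * (size (enc i) + p.[size (enc i)]%R) + 2)
   (upd (upd s 0 [::]) 0 [:: b]).
  have r1 := runs_clear (erefl (upd s 0 [::])).
  have r2 : runs (Push 0 b) (upd s 0 [::]) 1 (upd (upd s 0 [::]) 0 [:: b]).
    by apply: (@runs_ev (Push _ _)).
  by apply: runs_le (runs_seq r1 r2) _; lia.
have rm : runs (match s 0 with
    | [::] => Skip
    | true :: _ => Seq (clear 0) (Push 0 true)
    | false :: _ => Seq (clear 0) (Push 0 false)
    end) s (2 * (size (enc i) + p.[size (enc i)]%R) + 2) (upd (upd s 0 [::]) 0 [:: b]).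
  by move: (hne _ _ cy) hb; rewrite -sy; case: (s 0) => [|[] z] //= _ bE; rewrite bE.
have [t' ex' tp'] := runs_case rm.
exists (t + t'), (upd (upd s 0 [::]) 0 [:: b]); split=> //; first exact: exec_Seq ex ex'.
rewrite !(hornerD, hornerM, hornerX, hornerC).
rewrite -![(_ + _)%R]/(_ + _)%N -[(_ * _)%R]/(_ * _)%N.
move: tp tp'; set q := p.[_]%R; move: (size (enc i)) q => N q.
by clear; lia.
Qed.

Theorem theorem3p16 :
  polytime_solvable enc_graph TTO_search /\ polytime_decidable enc_graph TTO.
Proof.
have search : polytime_solvable enc_graph TTO_search.
  have [p hp] := poly_bounded_tto.
  exists tto_prog, p => G; have [y [s' [[t ex tle] s0 cy]]] := tto_correct G.
  exists y => //; exists t, s'; split=> //; exact: leq_trans tle (hp _).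
split=> //; apply: search_decidable search => G y.
  case=> [[F ttF ->]|[no ->]]; [exists true|exists false] => //; split=> // _.
  by exists F.
by case=> [[F _ ->]|[_ ->]].
Qed.
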